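(* Let $(E,C)$ be a finite bipartite separated graph and $K$ a field with involution. Put $A_n=L(E_n,C^n)$ for the canonical sequence $\{(E_n,C^n)\}_{n\ge0}$ of $(E,C)$, and let $\Phi_n=\phi_{n-1}\circ\cdots\circ\phi_0\colon A_0=L(E,C)\to A_n$ be the composition of the canonical surjections. Let $U$ be the subsemigroup of the multiplicative semigroup of $A_0$ generated by $\{x,x^*:x\in E^1\}$, and for $w\in U$ set $e(w)=ww^*$. For $n\ge1$, let $J_n$ be the ideal of $A_0$ generated by all the commutators $[e(w),e(w')]$ with $w,w'$ elements of $U$ which are products of $\le n$ generators from $\{x,x^*:x\in E^1\}$. Then $\ker(\Phi_n)=J_n$, so that $A_n\cong A_0/J_n$.
   Context: A separated graph is a pair $(E,C)$, where $E=(E^0,E^1,r,s)$ is a directed graph and $C=\bigsqcup_{v\in E^0}C_v$ with $C_v$ a partition of $r^{-1}(v)$ into nonempty subsets ($C_v=\emptyset$ if $r^{-1}(v)=\emptyset$). It is finite if $E^0,E^1$ are finite. It is bipartite if $E^0=E^{0,0}\sqcup E^{0,1}$, all arrows go from $E^{0,1}$ to $E^{0,0}$, $r(E^1)=E^{0,0}$ and $s(E^1)=E^{0,1}$. $L(E,C)=L_K(E,C)$ is the $*$-algebra over $K$ with generators $v\in E^0$, $e\in E^1$ and relations: $vv'=\delta_{v,v'}v$, $v=v^*$ ($v,v'\in E^0$); $r(e)e=e=es(e)$ ($e\in E^1$); $e^*e'=\delta_{e,e'}s(e)$ for $e,e'\in X$, $X\in C$; $v=\sum_{e\in X}ee^*$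 for every finite $X\in C_v$, $v\in E^0$. Canonical sequence: $(E_0,C^0)=(E,C)$; given $(E_n,C^n)$ with $C^n_u=\{X_1^u,\dots,X_{k_u}^u\}$ for $u\in E_n^{0,0}$, set $E_{n+1}^{0,0}=E_n^{0,1}$; $E_{n+1}^{0,1}=\{v(x_1,\dots,x_{k_u}):u\in E_n^{0,0},x_i\in X_i^u\}$ (distinct new vertices); $E_{n+1}^1$ consists of arrows $\alpha^{x_i}(x_1,\dots,\widehat{x_i},\dots,x_{k_u})$, for $u\in E_n^{0,0}$, $1\le i\le k_u$, $(x_1,\dots,x_{k_u})\in\prod_jX_j^u$, with range $s(x_i)$ and source $v(x_1,\dots,x_{k_u})$; and for $w\in E_{n+1}^{0,0}$, $C^{n+1}_w=\{X(x): x\in E_n^1, s(x)=w\}$ where for $x=x_i\in X_i^u$, $X(x_i)=\{\alpha^{x_i}(x_1,\dots,\widehat{x_i},\dots,x_{k_u}):x_j\in X_j^u,\ j\neq i\}$. The canonical surjective $*$-homomorphism $\phi_n\colon L(E_n,C^n)\to L(E_{n+1},C^{n+1})$ is defined by $\phi_n(w)=w$ for $w\in E_n^{0,1}$, $\phi_n(u)=\sum_{(x_1,\dots,x_{k_u})\in\prod_iX_i^u}v(x_1,\dots,x_{k_u})$ for $u\in E_n^{0,0}$, and $\phi_n(x_i)=\sum_{x_j\in X_j^u,\,j\ne i}\big(\alpha^{x_i}(x_1,\dots,\widehat{x_i},\dots,x_{k_u})\big)^*$ for $x_i\in X_i^u$. *)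

(* Defs.v *)
From HB Require Import structures.
From mathcomp Require Import all_boot all_algebra.
From mathcomp Require Import boolp.

Set Implicit Arguments.
Unset Strict Implicit.
Unset Printing Implicit Defensive.

Import GRing.Theory.
Local Open Scope ring_scope.
Local Open Scope quotient_scope.

(* Unital *-algebras over a field K with involution sigma.  The library's
   [algType] excludes the zero ring, which is the algebra of the empty graph,
   and its hierarchy admits no common extension of [pzRingType] and [lmodType],
   so the vector space structure is part of the mixin. *)
HB.mixin Record isStarAlgebra (K : fieldType) (sigma : involutive_rmorphism K) A
    of GRing.PzRing A := {
  sscale : K -> A -> A;
  star : A -> A;
  sscalerA : forall (b c : K) (a : A), sscale b (sscale c a) = sscale (b * c) a;
  sscale1r : forall a : A, sscale 1 a = a;
  sscalerDr : forall (c : K) (a b : A),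
    sscale c (a + b) = sscale c a + sscale c b;
  sscalerDl : forall (b c : K) (a : A),
    sscale (b + c) a = sscale b a + sscale c a;
  sscalerAl : forall (c : K) (a b : A), sscale c (a * b) = sscale c a * b;
  sscalerAr : forall (c : K) (a b : A), sscale c (a * b) = a * sscale c b;
  starK : forall a : A, star (star a) = a;
  starD : forall a b : A, star (a + b) = star a + star b;
  starM : forall a b : A, star (a * b) = star b * star a;
  starZ : forall (c : K) (a : A), star (sscale c a) = sscale (sigma c) (star a)
}.

#[short(type="starAlgType")]
HB.structure Definition StarAlgebra (K : fieldType)
    (sigma : involutive_rmorphism K) :=
  { A of GRing.PzRing A & isStarAlgebra K sigma A }.

Arguments star {K sigma s} _.
Arguments sscale {K sigma s} _ _.

Section StarTheory.
Variables (K : fieldType) (sigma : involutive_rmorphism K).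
Variable A : starAlgType sigma.

Lemma star0 : star (0 : A) = 0.
Proof. by apply: (addIr (star (0 : A))); rewrite -starD !add0r. Qed.

Lemma starN (a : A) : star (- a) = - star a.
Proof. by apply: (addIr (star a)); rewrite -starD !addNr star0. Qed.

Lemma sscaler0 (c : K) : sscale c (0 : A) = 0.
Proof. by apply: (addIr (sscale c (0 : A))); rewrite -sscalerDr !add0r. Qed.

Lemma sscale0r (a : A) : sscale 0 a = 0.
Proof. by apply: (addIr (sscale 0 a)); rewrite -sscalerDl !add0r. Qed.

Lemma sscalerN (c : K) (a : A) : sscale c (- a) = - sscale c a.
Proof. by apply: (addIr (sscale c a)); rewrite -sscalerDr !addNr sscaler0. Qed.

Lemma sscaleN1r (a : A) : sscale (- 1) a = - a.
Proof.
apply: (addIr a); rewrite -{2}[a]sscale1r -sscalerDl !addNr; exact: sscale0r.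
Qed.

Lemma starB (a b : A) : star (a - b) = star a - star b.
Proof. by rewrite starD starN. Qed.

Lemma star_sum I (r : seq I) (P : pred I) (F : I -> A) :
  star (\sum_(i <- r | P i) F i) = \sum_(i <- r | P i) star (F i).
Proof. by apply: (big_morph star starD star0). Qed.

End StarTheory.

Definition star_hom (K : fieldType) (sigma : involutive_rmorphism K)
    (A B : starAlgType sigma) (f : A -> B) : Prop :=
  [/\ forall a b, f (a + b) = f a + f b,
      forall (c : K) a, f (sscale c a) = sscale c (f a),
      forall a b, f (a * b) = f a * f b &
      forall a, f (star a) = star (f a)].

Section Ideals.
Variables (K : fieldType) (sigma : involutive_rmorphism K).
Variable A : starAlgType sigma.

Definition is_ideal (I : A -> Prop) : Prop :=
  [/\ I 0,
      forall a b, I a -> I b -> I (a + b),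
      forall (c : K) a, I a -> I (sscale c a),
      forall a b, I b -> I (a * b) &
      forall a b, I a -> I (a * b)].

Definition ideal_gen (S : A -> Prop) (a : A) : Prop :=
  forall I : A -> Prop, is_ideal I -> (forall b, S b -> I b) -> I a.

Lemma ideal_genP (S : A -> Prop) : is_ideal (ideal_gen S).
Proof.
split=> [I []//|a b Ia Ib I HI HS|c a Ia I HI HS|a b Ib I HI HS|a b Ia I HI HS];
  case: (HI) => H0 HD HZ HL HR.
- by apply: HD; [apply: Ia|apply: Ib].
- by apply: HZ; apply: Ia.
- by apply: HL; apply: Ib.
- by apply: HR; apply: Ia.
Qed.

Lemma ideal_gen_star (S : A -> Prop) :
  (forall a, S a -> ideal_gen S (star a)) ->
  forall a, ideal_gen S a -> ideal_gen S (star a).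
Proof.
move=> HS a h; apply: (h (fun b => ideal_gen S (star b))) => //; case: (ideal_genP S) => H0 HD HZ HL HR.
split=> [|b c Hb Hc|c b Hb|b c Hc|b c Hb].
- by rewrite star0.
- by rewrite starD; apply: HD.
- by rewrite starZ; apply: HZ.
- by rewrite starM; apply: HR.
- by rewrite starM; apply: HL.
Qed.

Record starIdeal := StarIdeal {
  sideal :> A -> Prop;
  sideal_ideal : is_ideal sideal;
  sideal_star : forall a, sideal a -> sideal (star a)
}.

End Ideals.

Section QuotientAlgebra.
Variables (K : fieldType) (sigma : involutive_rmorphism K).
Variables (A : starAlgType sigma) (I : starIdeal A).

Let I0 : I 0. Proof. by case: (sideal_ideal I). Qed.
Let ID a b : I a -> I b -> I (a + b).
Proof. by case: (sideal_ideal I) => _ h _ _ _; apply: h. Qed.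
Let IZ c a : I a -> I (sscale c a).
Proof. by case: (sideal_ideal I) => _ _ h _ _; apply: h. Qed.
Let IL a b : I b -> I (a * b).
Proof. by case: (sideal_ideal I) => _ _ _ h _; apply: h. Qed.
Let IR a b : I a -> I (a * b).
Proof. by case: (sideal_ideal I) => _ _ _ _ h; apply: h. Qed.
Let IN a : I a -> I (- a).
Proof. by move=> Ia; rewrite -sscaleN1r; apply: IZ. Qed.

Definition qrel : rel A := fun a b => `[< I (a - b) >].

Lemma qrel_equiv : equiv_class_of qrel.
Proof.
split=> [a|a b|b a c].
- by apply/asboolP; rewrite subrr.
- by apply/asboolP/asboolP => /IN; rewrite opprB.
- move=> /asboolP h1 /asboolP h2; apply/asboolP.
  by have := ID h1 h2; rewrite addrA subrK.
Qed.

Canonical qrel_canon := EquivRelPack qrel_equiv.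

Definition qalg : Type := {eq_quot qrel_canon}.
HB.instance Definition _ := Choice.on qalg.
HB.instance Definition _ : EqQuotient _ _ qalg := EqQuotient.on qalg.

Definition qproj (a : A) : qalg := \pi_qalg a.

Lemma qprojP (a b : A) : reflect (I (a - b)) (qproj a == qproj b).
Proof.
rewrite /qproj; apply: (iffP eqP) => [/eqmodP /asboolP //|h].
by apply/eqmodP/asboolP.
Qed.

Lemma qprojE (a b : A) : I (a - b) -> qproj a = qproj b.
Proof. by move=> h; apply/eqP/qprojP. Qed.

Lemma qproj_surj (q : qalg) : exists a, qproj a = q.
Proof. by exists (repr q); rewrite /qproj reprK. Qed.

Let qrepr a : I (repr (qproj a) - a).
Proof. by apply/qprojP; rewrite /qproj reprK. Qed.

Definition qzero : qalg := qproj 0.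
Definition qone : qalg := qproj 1.
Definition qadd (p q : qalg) : qalg := qproj (repr p + repr q).
Definition qopp (p : qalg) : qalg := qproj (- repr p).
Definition qmul (p q : qalg) : qalg := qproj (repr p * repr q).
Definition qscale (c : K) (p : qalg) : qalg := qproj (sscale c (repr p)).
Definition qstar (p : qalg) : qalg := qproj (star (repr p)).

Lemma qaddE a b : qadd (qproj a) (qproj b) = qproj (a + b).
Proof.
by apply: qprojE; rewrite opprD addrACA; apply: ID; apply: qrepr.
Qed.

Lemma qoppE a : qopp (qproj a) = qproj (- a).
Proof. by apply: qprojE; rewrite -opprD; apply: IN; apply: qrepr. Qed.

Lemma qmulE a b : qmul (qproj a) (qproj b) = qproj (a * b).
Proof.
apply: qprojE; set x := repr _; set y := repr _.
have -> : x * y - a * b = (x - a) * y + a * (y - b).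
  by rewrite mulrBl mulrBr addrA subrK.
by apply: ID; [apply: IR|apply: IL]; apply: qrepr.
Qed.

Lemma qscaleE c a : qscale c (qproj a) = qproj (sscale c a).
Proof. apply: qprojE; rewrite -sscalerN -sscalerDr; apply: IZ; exact: qrepr. Qed.

Lemma qstarE a : qstar (qproj a) = qproj (star a).
Proof. by apply: qprojE; rewrite -starB; apply: sideal_star; apply: qrepr. Qed.

Let qE := (qaddE, qoppE, qmulE, qscaleE, qstarE).

Local Ltac qelim := hnf; repeat
  match goal with |- forall q : qalg, _ =>
    let q := fresh "q" in let a := fresh "a" in
    move=> q; have [a <-] := qproj_surj q; clear q end.

Fact qaddA : associative qadd. Proof. by qelim; rewrite !qE addrA. Qed.
Fact qaddC : commutative qadd. Proof. by qelim; rewrite !qE addrC. Qed.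
Fact qadd0 : left_id qzero qadd. Proof. by qelim; rewrite !qE add0r. Qed.
Fact qaddN : left_inverse qzero qopp qadd.
Proof. by qelim; rewrite !qE addNr. Qed.
Fact qmulA : associative qmul. Proof. by qelim; rewrite !qE mulrA. Qed.
Fact qmul1l : left_id qone qmul. Proof. by qelim; rewrite !qE mul1r. Qed.
Fact qmul1r : right_id qone qmul. Proof. by qelim; rewrite !qE mulr1. Qed.
Fact qmulDl : left_distributive qmul qadd.
Proof. by qelim; rewrite !qE mulrDl. Qed.
Fact qmulDr : right_distributive qmul qadd.
Proof. by qelim; rewrite !qE mulrDr. Qed.

HB.instance Definition _ := GRing.isPzRing.Build qalg
  qaddA qaddC qadd0 qaddN qmulA qmul1l qmul1r qmulDl qmulDr.

Fact qscaleA (b c : K) (p : qalg) : qscale b (qscale c p) = qscale (b * c) p.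
Proof. by move: p; qelim; rewrite !qE sscalerA. Qed.
Fact qscale1 (p : qalg) : qscale 1 p = p.
Proof. by move: p; qelim; rewrite !qE sscale1r. Qed.
Fact qscaleDr (c : K) (p q : qalg) :
  qscale c (qadd p q) = qadd (qscale c p) (qscale c q).
Proof. by move: p q; qelim; rewrite !qE sscalerDr. Qed.
Fact qscaleDl (b c : K) (p : qalg) :
  qscale (b + c) p = qadd (qscale b p) (qscale c p).
Proof. by move: p; qelim; rewrite !qE sscalerDl. Qed.
Fact qscaleAl (c : K) (p q : qalg) :
  qscale c (qmul p q) = qmul (qscale c p) q.
Proof. by move: p q; qelim; rewrite !qE sscalerAl. Qed.
Fact qscaleAr (c : K) (p q : qalg) :
  qscale c (qmul p q) = qmul p (qscale c q).
Proof. by move: p q; qelim; rewrite !qE sscalerAr. Qed.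
Fact qstarK (p : qalg) : qstar (qstar p) = p.
Proof. by move: p; qelim; rewrite !qE starK. Qed.
Fact qstarD (p q : qalg) : qstar (qadd p q) = qadd (qstar p) (qstar q).
Proof. by move: p q; qelim; rewrite !qE starD. Qed.
Fact qstarM (p q : qalg) : qstar (qmul p q) = qmul (qstar q) (qstar p).
Proof. by move: p q; qelim; rewrite !qE starM. Qed.
Fact qstarZ (c : K) (p : qalg) : qstar (qscale c p) = qscale (sigma c) (qstar p).
Proof. by move: p; qelim; rewrite !qE starZ. Qed.

HB.instance Definition _ := isStarAlgebra.Build K sigma qalg
  qscaleA qscale1 qscaleDr qscaleDl qscaleAl qscaleAr qstarK qstarD qstarM qstarZ.

Lemma qproj_hom : star_hom qproj.
Proof. by split=> *; rewrite -?qE. Qed.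

End QuotientAlgebra.

(* [pres R] is the *-algebra over (K, sigma), with no unit in the signature,
   generated by X subject to the relations s = t for R s t: *-algebra
   expressions in X modulo the least congruence containing R and the axioms of
   (associative) *-algebras. *)
Section Presentation.

Inductive term (K X : Type) : Type :=
| TGen of X
| TZero
| TAdd of term K X & term K X
| TOpp of term K X
| TScale of K & term K X
| TMul of term K X & term K X
| TStar of term K X.

Arguments TZero {K X}.

HB.instance Definition _ (K X : Type) := gen_eqMixin (term K X).
HB.instance Definition _ (K X : Type) := gen_choiceMixin (term K X).

Variables (K : fieldType) (sigma : involutive_rmorphism K) (X : Type).
Local Notation T := (term K X).
Variable R : T -> T -> Prop.

Inductive pres_eq : T -> T -> Prop :=
| PE_rel s t : R s t -> pres_eq s t
| PE_refl s : pres_eq s s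
| PE_sym s t : pres_eq s t -> pres_eq t s
| PE_trans s t u : pres_eq s t -> pres_eq t u -> pres_eq s u
| PE_add s s' t t' :
    pres_eq s s' -> pres_eq t t' -> pres_eq (TAdd s t) (TAdd s' t')
| PE_opp s s' : pres_eq s s' -> pres_eq (TOpp s) (TOpp s')
| PE_scale c s s' : pres_eq s s' -> pres_eq (TScale c s) (TScale c s')
| PE_mul s s' t t' :
    pres_eq s s' -> pres_eq t t' -> pres_eq (TMul s t) (TMul s' t')
| PE_star s s' : pres_eq s s' -> pres_eq (TStar s) (TStar s')
| PE_addA s t u : pres_eq (TAdd s (TAdd t u)) (TAdd (TAdd s t) u)
| PE_addC s t : pres_eq (TAdd s t) (TAdd t s)
| PE_add0 s : pres_eq (TAdd TZero s) s
| PE_addN s : pres_eq (TAdd (TOpp s) s) TZero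
| PE_scaleA b c s : pres_eq (TScale b (TScale c s)) (TScale (b * c) s)
| PE_scale1 s : pres_eq (TScale 1 s) s
| PE_scaleDr c s t :
    pres_eq (TScale c (TAdd s t)) (TAdd (TScale c s) (TScale c t))
| PE_scaleDl b c s :
    pres_eq (TScale (b + c) s) (TAdd (TScale b s) (TScale c s))
| PE_mulA s t u : pres_eq (TMul s (TMul t u)) (TMul (TMul s t) u)
| PE_mulDl s t u : pres_eq (TMul (TAdd s t) u) (TAdd (TMul s u) (TMul t u))
| PE_mulDr s t u : pres_eq (TMul s (TAdd t u)) (TAdd (TMul s t) (TMul s u))
| PE_scaleAl c s t : pres_eq (TScale c (TMul s t)) (TMul (TScale c s) t)
| PE_scaleAr c s t : pres_eq (TScale c (TMul s t)) (TMul s (TScale c t))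
| PE_starK s : pres_eq (TStar (TStar s)) s
| PE_starD s t : pres_eq (TStar (TAdd s t)) (TAdd (TStar s) (TStar t))
| PE_starM s t : pres_eq (TStar (TMul s t)) (TMul (TStar t) (TStar s))
| PE_starZ c s : pres_eq (TStar (TScale c s)) (TScale (sigma c) (TStar s)).

Definition pres_rel : rel T := fun s t => `[< pres_eq s t >].

Lemma pres_rel_equiv : equiv_class_of pres_rel.
Proof.
split=> [s|s t|t s u].
- by apply/asboolP; apply: PE_refl.
- by apply/asboolP/asboolP => /PE_sym.
- by move=> /asboolP h1 /asboolP h2; apply/asboolP; apply: PE_trans h1 h2.
Qed.

Canonical pres_rel_canon := EquivRelPack pres_rel_equiv.

Definition pres : Type := {eq_quot pres_rel_canon}.
HB.instance Definition _ := Choice.on pres.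
HB.instance Definition _ : EqQuotient _ _ pres := EqQuotient.on pres.

Definition pcls (t : T) : pres := \pi_pres t.

Lemma pclsP s t : pcls s = pcls t <-> pres_eq s t.
Proof.
rewrite /pcls; split=> [/eqmodP /asboolP //|h].
by apply/eqmodP/asboolP.
Qed.

Lemma pclsE s t : pres_eq s t -> pcls s = pcls t.
Proof. by move/pclsP. Qed.

Lemma pcls_surj (q : pres) : exists t, pcls t = q.
Proof. by exists (repr q); rewrite /pcls reprK. Qed.

Lemma pcls_repr t : pres_eq (repr (pcls t)) t.
Proof. by apply/pclsP; rewrite /pcls reprK. Qed.

Definition pzero : pres := pcls TZero.
Definition padd (p q : pres) : pres := pcls (TAdd (repr p) (repr q)).
Definition popp (p : pres) : pres := pcls (TOpp (repr p)).
Definition pscale (c : K) (p : pres) : pres := pcls (TScale c (repr p)).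
Definition pmul (p q : pres) : pres := pcls (TMul (repr p) (repr q)).
Definition pstar (p : pres) : pres := pcls (TStar (repr p)).

Lemma paddE s t : padd (pcls s) (pcls t) = pcls (TAdd s t).
Proof. by apply: pclsE; apply: PE_add; apply: pcls_repr. Qed.
Lemma poppE s : popp (pcls s) = pcls (TOpp s).
Proof. by apply: pclsE; apply: PE_opp; apply: pcls_repr. Qed.
Lemma pscaleE c s : pscale c (pcls s) = pcls (TScale c s).
Proof. by apply: pclsE; apply: PE_scale; apply: pcls_repr. Qed.
Lemma pmulE s t : pmul (pcls s) (pcls t) = pcls (TMul s t).
Proof. by apply: pclsE; apply: PE_mul; apply: pcls_repr. Qed.
Lemma pstarE s : pstar (pcls s) = pcls (TStar s).
Proof. by apply: pclsE; apply: PE_star; apply: pcls_repr. Qed.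

Definition presE := (paddE, poppE, pscaleE, pmulE, pstarE).

Local Ltac pelim := hnf; repeat
  match goal with |- forall q : pres, _ =>
    let q := fresh "q" in let a := fresh "a" in
    move=> q; have [a <-] := pcls_surj q; clear q end.
Local Ltac psolve := pelim; rewrite !presE; apply: pclsE; by constructor.

Fact paddA : associative padd. Proof. by psolve. Qed.
Fact paddC : commutative padd. Proof. by psolve. Qed.
Fact padd0 : left_id pzero padd. Proof. by psolve. Qed.
Fact paddN : left_inverse pzero popp padd. Proof. by psolve. Qed.

HB.instance Definition _ := GRing.isZmodule.Build pres paddA paddC padd0 paddN.

Fact pscaleA (b c : K) (p : pres) : pscale b (pscale c p) = pscale (b * c) p.
Proof. by move: p; psolve. Qed.
Fact pscale1 (p : pres) : pscale 1 p = p. Proof. by move: p; psolve. Qed.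
Fact pscaleDr (c : K) (p q : pres) :
  pscale c (padd p q) = padd (pscale c p) (pscale c q).
Proof. by move: p q; psolve. Qed.
Fact pscaleDl (b c : K) (p : pres) :
  pscale (b + c) p = padd (pscale b p) (pscale c p).
Proof. by move: p; psolve. Qed.

Lemma pmulA : associative pmul. Proof. by psolve. Qed.
Fact pmulDl_subproof : left_distributive pmul padd. Proof. by psolve. Qed.
Lemma pmulDl : left_distributive pmul +%R. Proof. exact: pmulDl_subproof. Qed.
Fact pmulDr_subproof : right_distributive pmul padd. Proof. by psolve. Qed.
Lemma pmulDr : right_distributive pmul +%R. Proof. exact: pmulDr_subproof. Qed.
Lemma pscaleAl (c : K) (p q : pres) : pscale c (pmul p q) = pmul (pscale c p) q.
Proof. by move: p q; psolve. Qed.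
Lemma pscaleAr (c : K) (p q : pres) : pscale c (pmul p q) = pmul p (pscale c q).
Proof. by move: p q; psolve. Qed.
Lemma pstarK (p : pres) : pstar (pstar p) = p. Proof. by move: p; psolve. Qed.
Fact pstarD_subproof (p q : pres) : pstar (padd p q) = padd (pstar p) (pstar q).
Proof. by move: p q; psolve. Qed.
Lemma pstarD (p q : pres) : pstar (p + q) = pstar p + pstar q.
Proof. exact: pstarD_subproof. Qed.
Lemma pstarM (p q : pres) : pstar (pmul p q) = pmul (pstar q) (pstar p).
Proof. by move: p q; psolve. Qed.
Lemma pstarZ (c : K) (p : pres) : pstar (pscale c p) = pscale (sigma c) (pstar p).
Proof. by move: p; psolve. Qed.

Lemma pmul0 : right_zero 0 pmul.
Proof. by move=> p; apply: (addIr (pmul p 0)); rewrite -pmulDr !add0r. Qed.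
Lemma p0mul : left_zero 0 pmul.
Proof. by move=> p; apply: (addIr (pmul 0 p)); rewrite -pmulDl !add0r. Qed.
Lemma pmulN p q : pmul p (- q) = - pmul p q.
Proof. by apply: (addIr (pmul p q)); rewrite -pmulDr !addNr pmul0. Qed.
Lemma pNmul p q : pmul (- p) q = - pmul p q.
Proof. by apply: (addIr (pmul p q)); rewrite -pmulDl !addNr p0mul. Qed.

Fixpoint teval (A : starAlgType sigma) (g : X -> A) (t : T) : A :=
  match t with
  | TGen x => g x
  | TZero => 0
  | TAdd s t => teval g s + teval g t
  | TOpp s => - teval g s
  | TScale c s => sscale c (teval g s)
  | TMul s t => teval g s * teval g t
  | TStar s => star (teval g s)
  end.

Definition pres_lift (A : starAlgType sigma) (g : X -> A) (q : pres) : A :=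
  teval g (repr q).

Lemma teval_pres_eq (A : starAlgType sigma) (g : X -> A) :
  (forall s t, R s t -> teval g s = teval g t) ->
  forall s t, pres_eq s t -> teval g s = teval g t.
Proof.
move=> HR s t; elim=> {s t} //=.
- by move=> s t u _ -> _ ->.
- by move=> s s' t t' _ -> _ ->.
- by move=> s s' _ ->.
- by move=> c s s' _ ->.
- by move=> s s' t t' _ -> _ ->.
- by move=> s s' _ ->.
- by move=> *; rewrite addrA.
- by move=> *; rewrite addrC.
- by move=> *; rewrite add0r.
- by move=> *; rewrite addNr.
- by move=> *; rewrite sscalerA.
- by move=> *; rewrite sscale1r.
- by move=> *; rewrite sscalerDr.
- by move=> *; rewrite sscalerDl.
- by move=> *; rewrite mulrA.
- by move=> *; rewrite mulrDl.
- by move=> *; rewrite mulrDr.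
- by move=> *; rewrite sscalerAl.
- by move=> *; rewrite sscalerAr.
- by move=> *; rewrite starK.
- by move=> *; rewrite starD.
- by move=> *; rewrite starM.
- by move=> *; rewrite starZ.
Qed.

Lemma pres_liftE (A : starAlgType sigma) (g : X -> A) :
  (forall s t, R s t -> teval g s = teval g t) ->
  forall t, pres_lift g (pcls t) = teval g t.
Proof. by move=> HR t; apply: (teval_pres_eq HR); apply: pcls_repr. Qed.

End Presentation.

Arguments TZero {K X}.
Arguments TGen {K X} _.
Arguments pmul {K sigma X R} _ _.
Arguments pstar {K sigma X R} _.
Arguments padd {K sigma X R} _ _.
Arguments popp {K sigma X R} _.
Arguments pscale {K sigma X R} _ _.

(* Separated graphs with finitely many vertices and edges; [sg_part v] is C_v,
   and C is the union of the C_v. *)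
Record sepGraph := SepGraph {
  sg_vert : finType;
  sg_edge : finType;
  sg_src : sg_edge -> sg_vert;
  sg_rng : sg_edge -> sg_vert;
  sg_part : sg_vert -> {set {set sg_edge}};
  sg_partP : forall v, partition (sg_part v) (sg_rng @^-1: [set v])
}.

Section Leavitt.
Variables (K : fieldType) (sigma : involutive_rmorphism K) (G : sepGraph).

Local Notation gen := (sg_vert G + sg_edge G)%type.
Local Notation T := (term K gen).
Definition tvert (v : sg_vert G) : T := TGen (inl v).
Definition tedge (e : sg_edge G) : T := TGen (inr e).

Inductive leavitt_rel : T -> T -> Prop :=
| LR_vert v v' :
    leavitt_rel (TMul (tvert v) (tvert v')) (if v == v' then tvert v else TZero)
| LR_vstar v : leavitt_rel (tvert v) (TStar (tvert v))
| LR_rng e : leavitt_rel (TMul (tvert (sg_rng e)) (tedge e)) (tedge e)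
| LR_src e : leavitt_rel (tedge e) (TMul (tedge e) (tvert (sg_src e)))
| LR_orth v (X : {set sg_edge G}) e e' :
    X \in sg_part v -> e \in X -> e' \in X ->
    leavitt_rel (TMul (TStar (tedge e)) (tedge e'))
                (if e == e' then tvert (sg_src e) else TZero)
| LR_sum v (X : {set sg_edge G}) :
    X \in sg_part v ->
    leavitt_rel (tvert v)
      (\big[@TAdd K gen/TZero]_(e in X) TMul (tedge e) (TStar (tedge e))).

(* L_K(E,C) *)
Definition leavitt : Type := pres sigma leavitt_rel.
HB.instance Definition _ := GRing.Zmodule.on leavitt.

Local Notation cls := (@pcls K sigma gen leavitt_rel).

Definition lvert (v : sg_vert G) : leavitt := cls (tvert v).
Definition ledge (e : sg_edge G) : leavitt := cls (tedge e).

(* E^0 being finite, the sum of all vertices is a unit (lemma [lone_spec]). *)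
Definition lone : leavitt := \sum_v lvert v.
Local Notation lmul := (pmul : leavitt -> leavitt -> leavitt).

Lemma lone_spec (a : leavitt) : lmul lone a = a /\ lmul a lone = a.
Proof.
have sumr (I : finType) (F : I -> leavitt) b :
    lmul (\sum_i F i) b = \sum_i lmul (F i) b.
  by apply: (big_morph (fun x => lmul x b)) => [x y|];
     [apply: pmulDl|apply: p0mul].
have suml (I : finType) (F : I -> leavitt) b :
    lmul b (\sum_i F i) = \sum_i lmul b (F i).
  by apply: (big_morph (lmul b)) => [x y|]; [apply: pmulDr|apply: pmul0].
have vv v v' : lmul (lvert v) (lvert v') = if v == v' then lvert v else 0.
  rewrite /lvert presE; rewrite (pclsE (PE_rel _ (LR_vert v v'))).
  by case: eqP.
have vs v : pstar (lvert v) = lvert v.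
  by rewrite /lvert presE; apply: pclsE; apply: PE_sym; apply: PE_rel;
     apply: LR_vstar.
have os : pstar lone = lone.
  rewrite /lone (big_morph (pstar : leavitt -> leavitt) (@pstarD _ _ _ _) (_ : _ = 0)).
    by apply: eq_bigr => v _; apply: vs.
  by apply: (addIr (pstar 0)); rewrite -pstarD !add0r.
have ov v : lmul lone (lvert v) = lvert v.
  rewrite sumr (bigD1 v) //= vv eqxx big1 ?addr0 // => w /negbTE nw.
  by rewrite vv nw.
have vo v : lmul (lvert v) lone = lvert v.
  rewrite suml (bigD1 v) //= vv eqxx big1 ?addr0 // => w.
  by rewrite vv eq_sym => /negbTE ->.
have oe e : lmul lone (ledge e) = ledge e.
  have h : lmul (lvert (sg_rng e)) (ledge e) = ledge e.
    by rewrite /lvert /ledge presE; apply: pclsE; apply: PE_rel; apply: LR_rng.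
  by rewrite -{1}h pmulA ov.
have eo e : lmul (ledge e) lone = ledge e.
  have h : lmul (ledge e) (lvert (sg_src e)) = ledge e.
    rewrite /lvert /ledge presE; apply: pclsE; apply: PE_sym; apply: PE_rel.
    exact: LR_src.
  by rewrite -{1}h -pmulA vo.
have [t <-] := pcls_surj a.
elim: t => [[v|e]||s [s1 s2] t [t1 t2]|s [s1 s2]|c s [s1 s2]|s [s1 s2] t [t1 t2]
           |s [s1 s2]].
- by split; [apply: ov|apply: vo].
- by split; [apply: oe|apply: eo].
- by split; [apply: pmul0|apply: p0mul].
- by rewrite -paddE; split; [rewrite pmulDr s1 t1|rewrite pmulDl s2 t2].
- by rewrite -poppE; split; [rewrite pmulN s1|rewrite pNmul s2].
- rewrite -pscaleE; split; [rewrite -pscaleAr|rewrite -pscaleAl];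
    by congr (pscale c _).
- by rewrite -pmulE; split; [rewrite pmulA s1|rewrite -pmulA t2].
- by rewrite -pstarE; split; rewrite -{1}os -pstarM ?s1 ?s2.
Qed.

HB.instance Definition _ := GRing.Zmodule_isPzRing.Build leavitt
  (@pmulA K sigma gen leavitt_rel)
  (fun a => proj1 (lone_spec a)) (fun a => proj2 (lone_spec a))
  (@pmulDl K sigma gen leavitt_rel) (@pmulDr K sigma gen leavitt_rel).

HB.instance Definition _ := isStarAlgebra.Build K sigma leavitt
  (@pscaleA K sigma gen leavitt_rel) (@pscale1 K sigma gen leavitt_rel)
  (@pscaleDr K sigma gen leavitt_rel) (@pscaleDl K sigma gen leavitt_rel)
  (@pscaleAl K sigma gen leavitt_rel) (@pscaleAr K sigma gen leavitt_rel)
  (@pstarK K sigma gen leavitt_rel) (@pstarD K sigma gen leavitt_rel)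
  (@pstarM K sigma gen leavitt_rel) (@pstarZ K sigma gen leavitt_rel).

Lemma leavitt_vert v v' :
  lvert v * lvert v' = if v == v' then lvert v else 0.
Proof.
transitivity (cls (TMul (tvert v) (tvert v'))); first exact: pmulE.
by rewrite (pclsE (PE_rel _ (LR_vert v v'))); case: eqP.
Qed.

Lemma leavitt_vstar v : star (lvert v) = lvert v.
Proof.
transitivity (cls (TStar (tvert v))); first exact: pstarE.
by apply: pclsE; apply: PE_sym; apply: PE_rel; apply: LR_vstar.
Qed.

Lemma leavitt_rng e : lvert (sg_rng e) * ledge e = ledge e.
Proof.
transitivity (cls (TMul (tvert (sg_rng e)) (tedge e))); first exact: pmulE.
by apply: pclsE; apply: PE_rel; apply: LR_rng.
Qed.

Lemma leavitt_src e : ledge e * lvert (sg_src e) = ledge e.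
Proof.
transitivity (cls (TMul (tedge e) (tvert (sg_src e)))); first exact: pmulE.
by apply: pclsE; apply: PE_sym; apply: PE_rel; apply: LR_src.
Qed.

Lemma leavitt_orth v (X : {set sg_edge G}) e e' :
  X \in sg_part v -> e \in X -> e' \in X ->
  star (ledge e) * ledge e' = if e == e' then lvert (sg_src e) else 0.
Proof.
move=> hX he he'; transitivity (cls (TMul (TStar (tedge e)) (tedge e'))).
  by rewrite -pmulE -pstarE.
by rewrite (pclsE (PE_rel _ (LR_orth hX he he'))); case: eqP.
Qed.

Lemma leavitt_sum v (X : {set sg_edge G}) :
  X \in sg_part v -> lvert v = \sum_(e in X) ledge e * star (ledge e).
Proof.
move=> hX; rewrite /lvert (pclsE (PE_rel _ (LR_sum hX))).
apply: (big_rec2 (fun (t : T) (a : leavitt) => cls t = a)) => // e t a _ <-.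
by rewrite -paddE -pmulE -pstarE.
Qed.

End Leavitt.

(* E^{0,0} is [bg_up], E^{0,1} is [bg_low] and E^0 is their sum type.  The
   vertices of E^{0,1} receive no arrow, so C_v is only given on E^{0,0}. *)
Record bipGraph := BipGraph {
  bg_up : finType;
  bg_low : finType;
  bg_edge : finType;
  bg_src : bg_edge -> bg_low;
  bg_rng : bg_edge -> bg_up;
  bg_src_surj : forall w, exists e, bg_src e = w;
  bg_rng_surj : forall u, exists e, bg_rng e = u;
  bg_part : bg_up -> {set {set bg_edge}};
  bg_partP : forall u, partition (bg_part u) (bg_rng @^-1: [set u])
}.

Section SepOfBip.
Variable G : bipGraph.

Definition sob_part (v : bg_up G + bg_low G) : {set {set bg_edge G}} :=
  match v with inl u => bg_part u | inr _ => set0 end.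

Lemma sob_partP v :
  partition (sob_part v)
    ((fun e => inl (bg_rng e) : bg_up G + bg_low G) @^-1: [set v]).
Proof.
case: v => [u|w] /=.
  have := bg_partP u; congr (is_true (partition _ _)).
  by apply/setP => e; rewrite !inE.
rewrite (_ : _ @^-1: _ = set0); last by apply/setP => e; rewrite !inE.
by apply/and3P; split; rewrite ?inE // ?/cover ?/trivIset /cover !big_set0 ?cards0.
Qed.

Definition sep_of_bip : sepGraph :=
  @SepGraph (bg_up G + bg_low G)%type (bg_edge G)
    (fun e => inr (bg_src e)) (fun e => inl (bg_rng e)) sob_part sob_partP.

End SepOfBip.

Coercion sep_of_bip : bipGraph >-> sepGraph.

(* One step of the canonical sequence.  As the elements of C_u are disjoint, a
   tuple (x_1, ..., x_k) in \prod_i X_i is the same thing as a transversal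
   of the partition C_u of r^{-1}(u), and the arrow
   alpha^{x_i}(x_1, ..., ^x_i, ..., x_k) is given by the transversal
   {x_1, ..., x_k} together with its element x_i. *)
Section NextGraph.
Variable G : bipGraph.
Local Notation edge := (bg_edge G).
Local Notation fib := (fun u => @bg_rng G @^-1: [set u]).

Definition nvert :=
  {p : bg_up G * {set edge} | is_transversal p.2 (bg_part p.1) (fib p.1)}.

Definition nroot (v : nvert) : bg_up G := (val v).1.
Definition ntuple (v : nvert) : {set edge} := (val v).2.

Definition nedge := {p : nvert * edge | p.2 \in ntuple p.1}.

Definition nbase (a : nedge) : edge := (val a).2.
Definition nsrc (a : nedge) : nvert := (val a).1.
Definition nrng (a : nedge) : bg_low G := bg_src (nbase a).

Lemma nedge_inj (a b : nedge) : nsrc a = nsrc b -> nbase a = nbase b -> a = b.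
Proof.
move=> hs hb; apply: val_inj.
by rewrite [LHS]surjective_pairing [RHS]surjective_pairing; congr (_, _).
Qed.

(* X(x) *)
Definition nblock (x : edge) : {set nedge} := [set a | nbase a == x].

Definition npart (w : bg_low G) : {set {set nedge}} :=
  [set nblock x | x in [set x | bg_src x == w]].

Lemma ntuple_rng (v : nvert) x : x \in ntuple v -> bg_rng x = nroot v.
Proof.
case/and3P: (valP v) => _ /subsetP h _ /h.
by rewrite !inE => /eqP.
Qed.

Lemma ntuple_block (v : nvert) (X : {set edge}) :
  X \in bg_part (nroot v) -> exists2 x, x \in ntuple v & x \in X.
Proof.
case/and3P: (valP v) => _ _ /forall_inP h /h /cards1P [x Hx].
by have : x \in ntuple v :&: X;
  [rewrite /ntuple Hx inE | rewrite inE => /andP [? ?]; exists x].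
Qed.

Lemma ntuple_inj (v : nvert) (X : {set edge}) x y :
  X \in bg_part (nroot v) -> x \in ntuple v -> y \in ntuple v ->
  x \in X -> y \in X -> x = y.
Proof.
case/and3P: (valP v) => _ _ /forall_inP h /h /cards1P [z Hz] xv yv xX yX.
have hx : x \in ntuple v :&: X by rewrite inE xv.
have hy : y \in ntuple v :&: X by rewrite inE yv.
by move: hx hy; rewrite /ntuple Hz !inE => /eqP -> /eqP ->.
Qed.

Lemma nsrc_surj (v : nvert) : exists a, nsrc a = v.
Proof.
have [e he] := bg_rng_surj (nroot v).
have hc : e \in cover (bg_part (nroot v)).
  by rewrite (cover_partition (bg_partP _)) !inE he.
have [x xv _] := ntuple_block (pblock_mem hc).
by exists (exist _ (v, x) xv).
Qed.

Lemma nbase_surj (x : edge) : exists a, nbase a = x.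
Proof.
set P := bg_part (bg_rng x); have PP := bg_partP (bg_rng x).
have cP := cover_partition PP; have tP := partition_trivIset PP.
have hx : x \in cover P by rewrite cP !inE.
pose c (B : {set edge}) := if x \in B then x else odflt x [pick y in B].
have cB B : B \in P -> c B \in B.
  move=> BP; rewrite /c; case: ifP => // _; case: pickP => //= B0.
  have := partition_neq0 PP BP; case/set0Pn => y; by rewrite B0.
pose T := c @: P.
have hT : is_transversal T P (fib (bg_rng x)).
  apply/and3P; split=> //.
    apply/subsetP => y /imsetP [B BP ->]; rewrite -cP.
    by apply/bigcupP; exists B => //; apply: cB.
  apply/forall_inP => B BP; apply/cards1P; exists (c B).
  apply/setP => y; rewrite !inE; apply/andP/eqP => [[/imsetP [B' B'P ->] h]|->].
    by rewrite -(def_pblock tP B'P (cB _ B'P)) (def_pblock tP BP h).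
  by split; [apply: imset_f|apply: cB].
have xT : x \in T.
  apply/imsetP; exists (pblock P x); first exact: pblock_mem.
  by rewrite /c mem_pblock hx.
by exists (exist _ (exist _ (bg_rng x, T) hT : nvert, x) xT).
Qed.

Lemma nrng_surj (w : bg_low G) : exists a, nrng a = w.
Proof.
have [x <-] := bg_src_surj w; have [a <-] := nbase_surj x.
by exists a.
Qed.

Lemma npartP w : partition (npart w) (nrng @^-1: [set w]).
Proof.
apply/and3P; split.
- apply/eqP/setP => a; rewrite !inE; apply/bigcupP/eqP => [[B]|h].
    by case/imsetP => x; rewrite inE => /eqP <- ->; rewrite inE => /eqP <-.
  exists (nblock (nbase a)); last by rewrite inE.
  by apply: imset_f; rewrite inE -h.
- apply/trivIsetP => B B' /imsetP [x _ ->] /imsetP [y _ ->] hn.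
  rewrite -setI_eq0; apply/eqP/setP => a; rewrite !inE.
  by apply/andP => -[/eqP h1 /eqP h2]; rewrite -h1 -h2 eqxx in hn.
- apply/negP => /imsetP [x _ /setP h]; have [a ha] := nbase_surj x.
  by have := h a; rewrite !inE ha eqxx.
Qed.

Definition next : bipGraph :=
  @BipGraph (bg_low G) nvert nedge nsrc nrng nsrc_surj nrng_surj npart npartP.

End NextGraph.

Fixpoint canon (G : bipGraph) (n : nat) : bipGraph :=
  if n is m.+1 then next (canon G m) else G.

Section Phi.
Variables (K : fieldType) (sigma : involutive_rmorphism K) (G : bipGraph).
Local Notation A := (leavitt sigma G).
Local Notation B := (leavitt sigma (next G)).

Definition nvert0 (w : bg_low G) : B := @lvert K sigma (next G) (inl w).
Definition nvert1 (v : nvert G) : B := @lvert K sigma (next G) (inr v).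
Definition nalpha (a : nedge G) : B := @ledge K sigma (next G) a.

Definition phi_gen (x : sg_vert G + sg_edge G) : B :=
  match x with
  | inl (inl u) => \sum_(v | nroot v == u) nvert1 v
  | inl (inr w) => nvert0 w
  | inr x => \sum_(a | nbase a == x) star (nalpha a)
  end.

(* The evaluation at a representative does not depend on its choice, since
   [phi_gen] respects the relations of L(E,C) (lemma [phi_gen_rel]); [phi] is a
   *-homomorphism by [phi_hom]. *)
Definition phi : A -> B := pres_lift phi_gen.

Let sum_delta (I : finType) (P : pred I) i (F : I -> B) :
  \sum_(j | P j) (if i == j then F j else 0) = if P i then F i else 0.
Proof.
rewrite -big_mkcondr; case: ifP => Pi.
  rewrite (bigD1 i) /= ?Pi ?eqxx // big1 ?addr0 // => j /andP [/andP [_ /eqP ->]].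
  by rewrite eqxx.
by rewrite big1 // => j /andP [Pj /eqP h]; rewrite h Pj in Pi.
Qed.

Let n11 v v' : nvert1 v * nvert1 v' = if v == v' then nvert1 v else 0.
Proof. by rewrite /nvert1 (leavitt_vert sigma). Qed.
Let n00 w w' : nvert0 w * nvert0 w' = if w == w' then nvert0 w else 0.
Proof. by rewrite /nvert0 (leavitt_vert sigma). Qed.
Let n01 w v : nvert0 w * nvert1 v = 0.
Proof. by rewrite /nvert0 /nvert1 (leavitt_vert sigma). Qed.
Let n10 w v : nvert1 v * nvert0 w = 0.
Proof. by rewrite /nvert0 /nvert1 (leavitt_vert sigma). Qed.
Let s0 w : star (nvert0 w) = nvert0 w.
Proof. exact: leavitt_vstar. Qed.
Let s1 v : star (nvert1 v) = nvert1 v.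
Proof. exact: leavitt_vstar. Qed.
Let ar a : nvert0 (nrng a) * nalpha a = nalpha a.
Proof. exact: (@leavitt_rng K sigma (next G) a). Qed.
Let asrc a : nalpha a * nvert1 (nsrc a) = nalpha a.
Proof. exact: (@leavitt_src K sigma (next G) a). Qed.

Let nblock_part x : nblock x \in sg_part (inl (bg_src x) : sg_vert (next G)).
Proof. by apply: imset_f; rewrite inE. Qed.

Let aorth a a' : nbase a = nbase a' ->
  star (nalpha a) * nalpha a' = if a == a' then nvert1 (nsrc a) else 0.
Proof.
move=> h; apply: (leavitt_orth (G := next G) sigma (nblock_part (nbase a))).
  by rewrite inE.
by rewrite inE h.
Qed.

Let asum x : nvert0 (bg_src x) = \sum_(a | nbase a == x) nalpha a * star (nalpha a).
Proof.
rewrite /nvert0 (leavitt_sum (G := next G) sigma (nblock_part x)).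
by apply: eq_bigl => a; rewrite inE.
Qed.

Let vas v a : nvert1 v * star (nalpha a) =
  if nsrc a == v then star (nalpha a) else 0.
Proof.
rewrite -(asrc a) starM s1 mulrA n11 eq_sym.
by case: eqP => [->|] //; rewrite mul0r.
Qed.

Let aas a a' : nalpha a * star (nalpha a') =
  if nsrc a == nsrc a' then nalpha a * star (nalpha a') else 0.
Proof.
rewrite -{1}(asrc a) -mulrA vas eq_sym.
by case: eqP => // _; rewrite mulr0.
Qed.

Lemma phi_gen_rel s t : leavitt_rel s t ->
  teval phi_gen s = teval phi_gen t.
Proof.
move=> [[u|w] [u'|w']|[u|w]|x|x|[u|w] X x y|[u|w] X] /=; rewrite ?inE //.
- rewrite big_distrlr /=.
  rewrite (eq_bigr (fun v => if nroot v == u' then nvert1 v else 0)); last first.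
    move=> v _; rewrite -(sum_delta (fun j => nroot j == u') v nvert1).
    by apply: eq_bigr => v' _; rewrite n11; case: eqP => // ->.
  rewrite -big_mkcondr (_ : (inl u == inl u') = (u == u')) //.
  case: (eqVneq u u') => [->|n] /=.
    by apply: eq_bigl => v; rewrite andbb.
  by rewrite big1 // => v /andP [/eqP h1 /eqP h2]; rewrite -h1 -h2 eqxx in n.
- by rewrite mulr_suml big1 // => v _; rewrite n10.
- by rewrite mulr_sumr big1 // => v _; rewrite n01.
- rewrite n00 (_ : (inr w == inr w') = (w == w')) //.
  by case: ifP.
- by rewrite star_sum; apply: eq_bigr => v _; rewrite s1.
- rewrite mulr_sumr; apply: eq_bigr => a /eqP ha; rewrite mulr_suml.
  rewrite (eq_bigr (fun v => if nsrc a == v then star (nalpha a) else 0));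
    last by move=> v _; rewrite vas.
  rewrite sum_delta (_ : nroot _ == _) //.
  by rewrite -(@ntuple_rng G (nsrc a) x) // -ha; exact: (valP a).
- rewrite mulr_suml; apply: eq_bigr => a /eqP ha.
  by rewrite -{1}(ar a) starM s0 /nrng ha.
- move=> hX xX yX; rewrite star_sum big_distrlr /=.
  rewrite (eq_bigr (fun a => \sum_(a' | nbase a' == y) nalpha a * star (nalpha a')));
    last by move=> a _; apply: eq_bigr => a' _; rewrite starK.
  case: (eqVneq x y) => [<-|n] /=.
    rewrite asum; apply: eq_bigr => a /eqP ha.
    rewrite (bigD1 a) ?ha //= big1 ?addr0 // => a' /andP [/eqP ha' n].
    rewrite aas; case: eqP => // hs; case/eqP: n.
    by apply: nedge_inj; rewrite ?hs ?ha.
  apply: big1 => a /eqP ha; apply: big1 => a' /eqP ha'.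
  rewrite aas; case: eqP => // hs; case/eqP: n.
  have xa : x \in ntuple (nsrc a) by rewrite -ha; exact: (valP a).
  have ya : y \in ntuple (nsrc a) by rewrite hs -ha'; exact: (valP a').
  have hu : nroot (nsrc a) = u.
    rewrite -(ntuple_rng xa); apply/eqP.
    have : x \in cover (bg_part u) by apply/bigcupP; exists X.
    by rewrite (cover_partition (bg_partP u)) !inE.
  by apply: (@ntuple_inj G (nsrc a) X); rewrite ?hu.
- move=> hX.
  have TE (I : finType) (P : pred I) (F : I -> term K (sg_vert G + sg_edge G)) :
      teval phi_gen (\big[@TAdd _ _/TZero]_(i | P i) F i) =
      \sum_(i | P i) teval phi_gen (F i) :> B.
    exact: (big_morph (teval phi_gen)).
  rewrite TE /=.
  rewrite (eq_bigr (fun x => \sum_(a | nbase a == x) nvert1 (nsrc a))); last first.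
    move=> x _; rewrite star_sum big_distrlr /=.
    apply: eq_bigr => a ha.
    transitivity (if nbase a == x then nvert1 (nsrc a) else 0); last by rewrite ha.
    rewrite -(sum_delta (fun a' => nbase a' == x) a (fun a' => nvert1 (nsrc a'))).
    apply: eq_bigr => a' /eqP ha'.
    rewrite starK aorth ?ha' ?(eqP ha) //.
    by case: eqP => // ->.
  have hu x : x \in X -> bg_rng x = u.
    move=> xX; apply/eqP.
    have : x \in cover (bg_part u) by apply/bigcupP; exists X.
    by rewrite (cover_partition (bg_partP u)) !inE.
  rewrite (exchange_big_dep (fun a : nedge G => nbase a \in X)) /=; last first.
    by move=> x a xX /eqP ->.
  rewrite (eq_bigr (fun a => nvert1 (nsrc a))); last first.
    move=> a aX; rewrite (big_pred1 (nbase a)) // => x /=.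
    by case: (eqVneq x (nbase a)) => [->|_]; rewrite ?aX ?andbF.
  rewrite (partition_big (@nsrc G) (fun v => nroot v == u)) /=; last first.
    by move=> a aX; rewrite -(ntuple_rng (valP a)) (hu _ aX).
  apply: eq_bigr => v /eqP hv.
  have [|x xv xX] := @ntuple_block G v X; first by rewrite hv.
  rewrite (big_pred1 (exist _ (v, x) xv)) // => a /=.
  apply/andP/eqP => [[aX /eqP av]|->] /=; last by rewrite /nbase /nsrc /= xX eqxx.
  apply: nedge_inj => //=; apply: (@ntuple_inj G v X); rewrite ?hv // -av.
  exact: (valP a).
Qed.

Lemma phi_pcls t : phi (pcls _ _ t) = teval phi_gen t.
Proof. exact: (pres_liftE phi_gen_rel). Qed.

Lemma phi_hom : star_hom phi.
Proof.
split=> [a b|c a|a b|a].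
- have [s <-] := pcls_surj a; have [t <-] := pcls_surj b.
  by rewrite -[_ + _]/(padd _ _) paddE !phi_pcls.
- have [s <-] := pcls_surj a.
  by rewrite -[sscale _ _]/(pscale _ _) pscaleE !phi_pcls.
- have [s <-] := pcls_surj a; have [t <-] := pcls_surj b.
  by rewrite -[_ * _]/(pmul _ _) pmulE !phi_pcls.
- have [s <-] := pcls_surj a.
  by rewrite -[star _]/(pstar _) pstarE !phi_pcls.
Qed.

Lemma phi_up u :
  phi (@lvert K sigma G (inl u)) = \sum_(v | nroot v == u) nvert1 v.
Proof. exact: phi_pcls. Qed.

Lemma phi_low w : phi (@lvert K sigma G (inr w)) = nvert0 w.
Proof. exact: phi_pcls. Qed.

Lemma phi_edge x :
  phi (@ledge K sigma G x) = \sum_(a | nbase a == x) star (nalpha a).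
Proof. exact: phi_pcls. Qed.

End Phi.

Fixpoint Phi (K : fieldType) (sigma : involutive_rmorphism K) (G : bipGraph)
    (n : nat) : leavitt sigma G -> leavitt sigma (canon G n) :=
  if n is m.+1 then fun a => phi (Phi m a) else id.

Section CommutatorIdeal.
Variables (K : fieldType) (sigma : involutive_rmorphism K) (G : sepGraph).
Local Notation A := (leavitt sigma G).

Definition edge_or_star (l : sg_edge G * bool) : A :=
  if l.2 then star (ledge sigma l.1) else ledge sigma l.1.

(* U has no empty product. *)
Definition in_U_le (n : nat) (w : A) : Prop :=
  exists2 s : seq (sg_edge G * bool),
    (0 < size s <= n)%N & w = \prod_(l <- s) edge_or_star l.

Definition range_proj (w : A) : A := w * star w.

Definition commutator (a b : A) : A := a * b - b * a.

Definition J_gens (n : nat) (a : A) : Prop :=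
  exists w w', [/\ in_U_le n w, in_U_le n w' &
                   a = commutator (range_proj w) (range_proj w')].

Lemma J_star (n : nat) (a : A) :
  ideal_gen (J_gens n) a -> ideal_gen (J_gens n) (star a).
Proof.
move: a; apply: ideal_gen_star => a [w [w' [hw hw' ->]]] I _; apply.
exists w', w; split=> //.
by rewrite /commutator /range_proj starB !starM !starK.
Qed.

Definition J (n : nat) : starIdeal A :=
  StarIdeal (ideal_genP (J_gens n)) (@J_star n).

End CommutatorIdeal.

(* Main.v *)
From HB Require Import structures.
From mathcomp Require Import all_boot all_algebra.
From mathcomp Require Import boolp.
Require Import Defs.

Set Implicit Arguments.
Unset Strict Implicit.
Unset Printing Implicit Defensive.

Import GRing.Theory.
Local Open Scope ring_scope.

(** Write e(w) = w w^*.  Both inclusions rest on one observation about a single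
    step phi : L(G) -> L(G'), G' being the next graph of the canonical sequence:
    phi makes the elements e(x), x an edge of G, commute, and it is universal
    for this property.

    Universality ([phi_factorization]).  Let h : L(G) -> B be a *-homomorphism
    such that the projections h(e(x)) commute.  For a new vertex v(T),
    T = (x_1, ..., x_k) a choice of one edge in each block of C_u, put
    P_T = prod_i h(e(x_i)).  Since the e(x), x in a block of C_u, are orthogonal
    with sum u, multiplying out over the blocks shows that the P_T are
    orthogonal with sum h(u).  Hence v(T) |-> P_T,
    alpha^{x_i}(T) |-> h(x_i)^* P_T respects the relations of L(G') and gives
    psi with psi o phi = h.  Taking h = phi one finds v(T) = prod_i phi(e(x_i)),
    so phi is surjective.

    The kernel of Phi_n lies in J_n ([Phi_factorization]).  Let h be the
    projection of A_0 onto A_0/J_n, so that h(e(w)) and h(e(w')) commute for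
    words w, w' of length at most n.  Universality is applied n times to get
    k_m : A_m -> A_0/J_n with k_m o Phi_m = h for m <= n; then Phi_n(a) = 0
    forces h(a) = k_n(0) = 0.  To take a step from m to m+1 the elements
    k_m(e(f)), f an edge of E_m, have to commute.  This follows from the
    induction hypothesis k_m(f) = h(l) p, where l is one of the generators x, x^*
    of U and p is a product of elements h(e(w)) with w of length at most m: as
    h(l) h(e(w)) h(l)^* = h(e(lw)) and h(l) is a partial isometry, k_m(e(f)) is
    a product of elements h(e(w)) with w of length at most m+1.

    J_n lies in the kernel of Phi_n ([Phi_range_proj_diag]).  Commutation in A_n
    is clear for sums of vertices, so it suffices that Phi_n(e(w)) is a sum of
    vertices when w has length at most n.  By induction,
    Phi_{n+1}(e(lw)) = phi(Phi_n(l) d Phi_n(l)^* ) with d a sum of vertices of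
    E_n.  Now Phi_n(l) is, up to the involution, a sum of edges which have
    pairwise distinct sources and which share a block as soon as they have the
    same range ([transverse]).  So the cross terms of Phi_n(l) d Phi_n(l)^*
    vanish; what remains are elements e(f) with f an edge, or vertices, and phi
    maps them to sums of vertices. *)

(** * Homomorphisms of *-algebras, products in rings *)

Section StarHom.
Variables (K : fieldType) (sigma : involutive_rmorphism K).
Variables (A B C : starAlgType sigma).

Lemma hom0 (f : A -> B) : star_hom f -> f 0 = 0.
Proof. by case=> fD _ _ _; apply: (addIr (f 0)); rewrite -fD !add0r. Qed.

Lemma homN (f : A -> B) (a : A) : star_hom f -> f (- a) = - f a.
Proof.
move=> hf; case: (hf) => fD _ _ _.
by apply: (addIr (f a)); rewrite -fD !addNr hom0.
Qed.

Lemma homB (f : A -> B) (a b : A) : star_hom f -> f (a - b) = f a - f b.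
Proof. by move=> hf; case: (hf) => fD _ _ _; rewrite fD homN. Qed.

Lemma hom_sum (f : A -> B) I (r : seq I) (P : pred I) (F : I -> A) :
  star_hom f -> f (\sum_(i <- r | P i) F i) = \sum_(i <- r | P i) f (F i).
Proof.
by move=> hf; case: (hf) => fD _ _ _; apply: (big_morph f fD (hom0 hf)).
Qed.

Lemma star1 : star (1 : A) = 1.
Proof. by rewrite -[LHS]mulr1 -{2}[1]starK -starM mulr1 starK. Qed.

Lemma star_hom_comp (f : A -> B) (g : B -> C) :
  star_hom f -> star_hom g -> star_hom (fun a => g (f a)).
Proof.
move=> [fD fZ fM fS] [gD gZ gM gS].
by split=> *; rewrite ?fD ?fZ ?fM ?fS ?gD ?gZ ?gM ?gS.
Qed.

End StarHom.

Section RingProducts.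
Variable R : pzRingType.

Lemma prod_fixl (I : finType) (P : pred I) (F : I -> R) (q : R) :
  (forall i, P i -> F i * q = q) -> (\prod_(i | P i) F i) * q = q.
Proof.
move=> h; apply: (big_ind (fun p => p * q = q)) => //; first by rewrite mul1r.
by move=> p p' hp hp'; rewrite -mulrA hp'.
Qed.

Lemma prod_fixr (I : finType) (P : pred I) (F : I -> R) (q : R) :
  (forall i, P i -> q * F i = q) -> q * (\prod_(i | P i) F i) = q.
Proof.
move=> h; apply: (big_ind (fun p => q * p = q)) => //; first by rewrite mulr1.
by move=> p p' hp hp'; rewrite mulrA hp.
Qed.

(** The factors may fail to commute among themselves, so that F i has to be moved
    to its own position from the left. *)
Lemma prod_absorb (I : finType) (A : {set I}) (F : I -> R) i :
  (forall j, F i * F j = F j * F i) -> F i * F i = F i -> i \in A ->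
  F i * (\prod_(j in A) F j) = \prod_(j in A) F j.
Proof.
move=> hc hi iA; rewrite -big_filter.
have : i \in [seq j <- index_enum I | j \in A].
  by rewrite mem_filter iA mem_index_enum.
elim: [seq _ <- _ | _] => //= j s IHs.
rewrite inE big_cons mulrA => /predU1P [<-|/IHs h]; first by rewrite hi.
by rewrite hc -mulrA h.
Qed.

End RingProducts.

(** * Generators and relations of a Leavitt algebra *)

Section LeavittAlgebra.
Variables (K : fieldType) (sigma : involutive_rmorphism K) (G : sepGraph).
Local Notation A := (leavitt sigma G).

Lemma leavitt_ind (P : A -> Prop) :
  P 0 -> (forall a b, P a -> P b -> P (a + b)) ->
  (forall c a, P a -> P (sscale c a)) ->
  (forall a b, P a -> P b -> P (a * b)) ->
  (forall a, P a -> P (star a)) ->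
  (forall v, P (lvert sigma v)) -> (forall e, P (ledge sigma e)) ->
  forall a, P a.
Proof.
move=> P0 PD PZ PM PS Pv Pe a; have [t <-] := pcls_surj a.
elim: t => [[v|e]||s hs t ht|s hs|c s hs|s hs t ht|s hs].
- exact: Pv.
- exact: Pe.
- exact: P0.
- by rewrite -paddE; apply: PD.
- rewrite -poppE -[popp _]/(- (pcls sigma _ s : A)) -sscaleN1r; exact: PZ.
- by rewrite -pscaleE; apply: PZ.
- by rewrite -pmulE; apply: PM.
- by rewrite -pstarE; apply: PS.
Qed.

Lemma star_hom_ext (B : starAlgType sigma) (f g : A -> B) :
  star_hom f -> star_hom g ->
  (forall v, f (lvert sigma v) = g (lvert sigma v)) ->
  (forall e, f (ledge sigma e) = g (ledge sigma e)) -> forall a, f a = g a.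
Proof.
move=> hf hg hv he; case: (hf) => fD fZ fM fS; case: (hg) => gD gZ gM gS.
apply: leavitt_ind => //.
- by rewrite (hom0 hf) (hom0 hg).
- by move=> a b ha hb; rewrite fD gD ha hb.
- by move=> c a ha; rewrite fZ gZ ha.
- by move=> a b ha hb; rewrite fM gM ha hb.
- by move=> a ha; rewrite fS gS ha.
Qed.

Section Lift.
Variables (B : starAlgType sigma) (g : sg_vert G + sg_edge G -> B).
Hypothesis g_vert : forall v v',
  g (inl v) * g (inl v') = if v == v' then g (inl v) else 0.
Hypothesis g_vstar : forall v, star (g (inl v)) = g (inl v).
Hypothesis g_rng : forall e, g (inl (sg_rng e)) * g (inr e) = g (inr e).
Hypothesis g_src : forall e, g (inr e) * g (inl (sg_src e)) = g (inr e).
Hypothesis g_orth : forall v (X : {set sg_edge G}) e e',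
  X \in sg_part v -> e \in X -> e' \in X ->
  star (g (inr e)) * g (inr e') = if e == e' then g (inl (sg_src e)) else 0.
Hypothesis g_sum : forall v (X : {set sg_edge G}), X \in sg_part v ->
  g (inl v) = \sum_(e in X) g (inr e) * star (g (inr e)).

Lemma leavitt_lift : exists f : A -> B,
  [/\ star_hom f, forall v, f (lvert sigma v) = g (inl v) &
      forall e, f (ledge sigma e) = g (inr e)].
Proof.
pose f : A -> B := pres_lift g.
have fE t : f (pcls sigma _ t) = teval g t.
  apply: pres_liftE => {}t t' [v v'|v|e|e|v X e e' hX he he'|v X hX] /=.
  - by rewrite g_vert; case: eqP.
  - by rewrite g_vstar.
  - exact: g_rng.
  - by rewrite g_src.
  - by rewrite (g_orth hX he he'); case: eqP.
  - rewrite (g_sum hX); symmetry.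
    exact: (big_morph (teval g)).
exists f; split=> [|v|e]; try exact: fE.
split=> [a b|c a|a b|a].
- have [s <-] := pcls_surj a; have [t <-] := pcls_surj b.
  by rewrite -[_ + _]/(padd _ _) paddE !fE.
- have [s <-] := pcls_surj a.
  by rewrite -[sscale _ _]/(pscale _ _) pscaleE !fE.
- have [s <-] := pcls_surj a; have [t <-] := pcls_surj b.
  by rewrite -[_ * _]/(pmul _ _) pmulE !fE.
- have [s <-] := pcls_surj a.
  by rewrite -[star _]/(pstar _) pstarE !fE.
Qed.

End Lift.
End LeavittAlgebra.

(** * Choices of one edge in each block *)

Section BipartiteGraphs.
Variable G : bipGraph.

Lemma block_of (x : bg_edge G) :
  exists2 X, X \in bg_part (bg_rng x) & x \in X.
Proof.
have hx : x \in cover (bg_part (bg_rng x)).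
  by rewrite (cover_partition (bg_partP _)) !inE.
by exists (pblock (bg_part (bg_rng x)) x); rewrite ?pblock_mem ?mem_pblock.
Qed.

Lemma block_rng u (X : {set bg_edge G}) x :
  X \in bg_part u -> x \in X -> bg_rng x = u.
Proof.
move=> hX xX; apply/eqP.
have : x \in cover (bg_part u) by apply/bigcupP; exists X.
by rewrite (cover_partition (bg_partP u)) !inE.
Qed.

Lemma bg_part_neq0 (u : bg_up G) : exists X, X \in bg_part u.
Proof. by have [x <-] := bg_rng_surj u; have [X] := block_of x; exists X. Qed.

Lemma ntuple_neq0 (T : nvert G) : exists x, x \in ntuple T.
Proof.
have [X /ntuple_block [x xT _]] := bg_part_neq0 (nroot T).
by exists x.
Qed.

(** Both sides have as many elements as there are blocks at the common root. *)
Lemma nvert_eq (S T : nvert G) : ntuple S \subset ntuple T -> S = T.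
Proof.
move=> sST; have [x xS] := ntuple_neq0 S.
have hr : nroot S = nroot T.
  by rewrite -(ntuple_rng xS) (ntuple_rng (subsetP sST _ xS)).
apply: val_inj; rewrite [LHS]surjective_pairing [RHS]surjective_pairing.
congr (_, _); [exact: hr | apply/eqP; rewrite eqEcard sST /=].
rewrite (card_transversal (valP S)) (card_transversal (valP T)).
by rewrite -/(nroot S) hr leqnn.
Qed.

Lemma choice_nvert u (f : {set bg_edge G} -> bg_edge G) :
  (forall X, X \in bg_part u -> f X \in X) ->
  exists2 T : nvert G, nroot T = u & ntuple T = f @: bg_part u.
Proof.
move=> hf; have tP := partition_trivIset (bg_partP u).
have hT : is_transversal (f @: bg_part u) (bg_part u) (@bg_rng G @^-1: [set u]).
  apply/and3P; split; first exact: bg_partP.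
    apply/subsetP => y /imsetP [X hX ->].
    by rewrite !inE (block_rng hX (hf _ hX)).
  apply/forall_inP => X hX; apply/cards1P; exists (f X).
  apply/setP => y; rewrite !inE; apply/andP/eqP => [[/imsetP [Y hY ->] h]|->].
    by rewrite -(def_pblock tP hY (hf _ hY)) (def_pblock tP hX h).
  by split; [apply: imset_f|apply: hf].
by exists (exist _ (u, f @: bg_part u) hT).
Qed.

Lemma nedge_of (T : nvert G) x : x \in ntuple T ->
  exists2 a, nsrc a = T & nbase a = x.
Proof. by move=> xT; exists (exist _ (T, x) xT). Qed.

Lemma nbase_in (a : nedge G) : nbase a \in ntuple (nsrc a).
Proof. exact: (valP a). Qed.

Lemma sum_nbase (V : nmodType) x (F : nvert G -> V) :
  \sum_(a | nbase a == x) F (nsrc a) = \sum_(T | x \in ntuple T) F T.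
Proof.
rewrite (partition_big (@nsrc G) (fun T => x \in ntuple T)) /=; last first.
  by move=> a /eqP <-; apply: nbase_in.
apply: eq_bigr => T xT; have [a aT ax] := nedge_of xT.
rewrite (big_pred1 a) ?aT // => b /=.
apply/andP/eqP => [[/eqP bx /eqP bT]|->]; last by rewrite ax aT !eqxx.
by apply: nedge_inj; rewrite ?bT ?bx.
Qed.

End BipartiteGraphs.

(** * The universal property of one step of the canonical sequence *)

Section Factorization.
Variables (K : fieldType) (sigma : involutive_rmorphism K) (G : bipGraph).
Variables (B : starAlgType sigma) (h : leavitt sigma G -> B).
Hypothesis hh : star_hom h.

Let hM a b : h (a * b) = h a * h b. Proof. by case: hh. Qed.
Let hS a : h (star a) = star (h a). Proof. by case: hh. Qed.

Definition edge_proj (x : bg_edge G) : B :=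
  h (ledge sigma (x : sg_edge G) * star (ledge sigma (x : sg_edge G))).

Hypothesis ec : forall x y,
  edge_proj x * edge_proj y = edge_proj y * edge_proj x.

Let U u : B := h (@lvert K sigma G (inl u)).
Let W w : B := h (@lvert K sigma G (inr w)).
Let E x : B := h (@ledge K sigma G x).

Let eE x : edge_proj x = E x * star (E x).
Proof. by rewrite /edge_proj hM hS. Qed.

Let vv v v' : h (@lvert K sigma G v) * h (@lvert K sigma G v') =
  if v == v' then h (@lvert K sigma G v) else 0.
Proof. by rewrite -hM leavitt_vert; case: eqP => // _; apply: hom0. Qed.

Let vs v : star (h (@lvert K sigma G v)) = h (@lvert K sigma G v).
Proof. by rewrite -hS leavitt_vstar. Qed.

Let UE x : U (bg_rng x) * E x = E x.
Proof. by rewrite -hM (@leavitt_rng K sigma G x). Qed.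

Let EW x : E x * W (bg_src x) = E x.
Proof. by rewrite -hM (@leavitt_src K sigma G x). Qed.

Let EsE x : star (E x) * E x = W (bg_src x).
Proof.
have [X hX xX] := block_of x.
rewrite -hS -hM (@leavitt_orth K sigma G (inl (bg_rng x)) X x x hX xX xX).
by rewrite eqxx.
Qed.

Let EsE' u (X : {set bg_edge G}) x y :
  X \in bg_part u -> x \in X -> y \in X -> x != y -> star (E x) * E y = 0.
Proof.
move=> hX xX yX /negbTE n.
rewrite -hS -hM (@leavitt_orth K sigma G (inl u) X x y hX xX yX) n.
exact: hom0.
Qed.

Let eEx x : edge_proj x * E x = E x.
Proof. by rewrite eE -mulrA EsE EW. Qed.

Let ee x : edge_proj x * edge_proj x = edge_proj x.
Proof. by rewrite {2}eE mulrA eEx -eE. Qed.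

Let es x : star (edge_proj x) = edge_proj x.
Proof. by rewrite eE starM starK. Qed.

Let e0 u (X : {set bg_edge G}) x y :
  X \in bg_part u -> x \in X -> y \in X -> x != y ->
  edge_proj x * edge_proj y = 0.
Proof.
move=> hX xX yX n; rewrite !eE mulrA -[E x * _ * _]mulrA.
by rewrite (EsE' hX xX yX n) mulr0 mul0r.
Qed.

Let esum u X : X \in bg_part u -> \sum_(x in X) edge_proj x = U u.
Proof.
move=> hX; rewrite /U (@leavitt_sum K sigma G (inl u) X hX).
by rewrite (hom_sum _ _ _ hh).
Qed.

Let Ue u x : U u * edge_proj x = if bg_rng x == u then edge_proj x else 0.
Proof.
rewrite eE -(UE x) !mulrA vv (_ : (inl _ == inl _) = (u == bg_rng x)) // eq_sym.
by case: eqP => [->|_] //; rewrite !mul0r.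
Qed.

(** The image forced on the vertex v(T). *)
Definition tuple_proj (T : nvert G) : B := \prod_(x in ntuple T) edge_proj x.

Let eT T x : x \in ntuple T -> edge_proj x * tuple_proj T = tuple_proj T.
Proof. by move=> xT; apply: prod_absorb. Qed.

Let eTc T x : edge_proj x * tuple_proj T = tuple_proj T * edge_proj x.
Proof. by apply: commr_prod => y _; apply: ec. Qed.

(* The reversed product p^* satisfies p p^* = p^*, each factor of p being
   absorbed by p^*; so p^* is self-adjoint. *)
Let Ts T : star (tuple_proj T) = tuple_proj T.
Proof.
have h1 : tuple_proj T * star (tuple_proj T) = star (tuple_proj T).
  apply: prod_fixl => x xT.
  by rewrite -{1}[edge_proj x]es -starM -eTc eT.
by have := congr1 star h1; rewrite starM starK h1.
Qed.

Let TT T : tuple_proj T * tuple_proj T = tuple_proj T.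
Proof. by apply: prod_fixl => x xT; apply: eT. Qed.

Let UT T : U (nroot T) * tuple_proj T = tuple_proj T.
Proof.
have [x xT] := ntuple_neq0 T.
by rewrite -(eT xT) mulrA Ue (ntuple_rng xT) eqxx.
Qed.

Lemma tuple_proj_up T : tuple_proj T * U (nroot T) = tuple_proj T.
Proof. by rewrite -{1}Ts -{1}[U _]vs -starM UT Ts. Qed.

Let eT0 T x : x \notin ntuple T -> edge_proj x * tuple_proj T = 0.
Proof.
move=> xT; case: (eqVneq (bg_rng x) (nroot T)) => [hr|n].
  have [X hX xX] := block_of x; rewrite hr in hX.
  have [y yT yX] := ntuple_block hX.
  rewrite -(eT yT) mulrA (e0 hX xX yX) ?mul0r //.
  by apply: contraNneq xT => ->.
rewrite eTc -tuple_proj_up -mulrA Ue (negbTE n); exact: mulr0.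
Qed.

Let eTE T x :
  edge_proj x * tuple_proj T = if x \in ntuple T then tuple_proj T else 0.
Proof. by case: ifPn => [/eT|/eT0]. Qed.

(** Two distinct choices differ at some edge x of S outside T, and then e(x)
    fixes P_S and kills P_T. *)
Lemma tuple_proj_mul S T :
  tuple_proj S * tuple_proj T = if S == T then tuple_proj S else 0.
Proof.
case: eqP => [<-|n]; first exact: TT.
have /subsetPn [x xS xT] : ~~ (ntuple S \subset ntuple T).
  by apply/negP => /nvert_eq.
by rewrite -(eT xS) eTc -mulrA eT0 ?mulr0.
Qed.

Let UU u : U u * U u = U u.
Proof. by rewrite vv eqxx. Qed.

Let prodU u : \prod_(X in bg_part u) U u = U u.
Proof.
have [X hX] := bg_part_neq0 u.
have h1 := @prod_absorb B _ (bg_part u) (fun=> U u) X (fun=> erefl) (UU u) hX.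
by rewrite -h1; apply: prod_fixr.
Qed.

(** Multiplying out u = prod_X (sum_(x in X) e(x)) over the blocks X at u gives a
    sum over choice functions f.  Rather than matching these terms with the
    vertices v(T), it is shown that the defect r, which satisfies u r = r, is
    killed by each of them: such a term is absorbed by P_T, T the image of f,
    and P_T r = 0. *)
Lemma sum_tuple_proj u : \sum_(T | nroot T == u) tuple_proj T = U u.
Proof.
pose r := U u - \sum_(T | nroot T == u) tuple_proj T.
have Tr T : nroot T = u -> tuple_proj T * r = 0.
  move=> hT; rewrite mulrBr -{1}hT tuple_proj_up mulr_sumr (bigD1 T) ?hT //= TT.
  rewrite big1 ?addr0 ?subrr // => S /andP [_ n].
  by rewrite tuple_proj_mul eq_sym (negbTE n).
have Ur : U u * r = r.
  rewrite mulrBr UU; congr (_ - _); rewrite mulr_sumr.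
  by apply: eq_bigr => T /eqP <-; apply: UT.
(* x0 is the value of choice functions outside of the blocks at u. *)
have [x0 _] := bg_rng_surj u.
suff : r = 0 by move=> /eqP; rewrite subr_eq0 => /eqP.
rewrite -Ur -prodU.
rewrite (eq_bigr (fun X : {set bg_edge G} => \sum_(x in X) edge_proj x));
  last by move=> X hX; rewrite (esum hX).
rewrite (big_distr_big_dep x0) mulr_suml big1 // => f /pfamilyP [_ hf].
have [T hT fT] := choice_nvert hf.
set p := \prod_(X in _) _.
have pT : p * tuple_proj T = p.
  apply: prod_fixr => x; rewrite fT => /imsetP [X hX ->].
  rewrite -[_ * _](commr_prod _ (fun Y _ => ec (f X) (f Y))).
  exact: (@prod_absorb B _ (bg_part u) (fun X => edge_proj (f X))).
by rewrite -pT -mulrA Tr // mulr0.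
Qed.

Lemma sum_tuple_proj_edge x :
  \sum_(T | x \in ntuple T) tuple_proj T = edge_proj x.
Proof.
have eU : edge_proj x * U (bg_rng x) = edge_proj x.
  by rewrite -{1}es -{1}[U _]vs -starM Ue eqxx es.
rewrite -eU -sum_tuple_proj mulr_sumr [RHS](eq_bigr (fun T =>
  if x \in ntuple T then tuple_proj T else 0)) => [|T _]; last exact: eTE.
rewrite -big_mkcondr; apply: eq_bigl => T.
by case xT: (x \in _); rewrite ?andbF // (ntuple_rng xT) eqxx.
Qed.

(* The value on the arrow alpha^x(T) is forced as well: in L(G') one has
   alpha^x(T) = phi(x)^* v(T). *)
Let psi_gen (g : sg_vert (next G) + sg_edge (next G)) : B :=
  match g with
  | inl (inl w) => W w
  | inl (inr T) => tuple_proj T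
  | inr a => star (E (nbase a)) * tuple_proj (nsrc a)
  end.

Let WT w T : W w * tuple_proj T = 0.
Proof. by rewrite -UT mulrA vv mul0r. Qed.

Let TW w T : tuple_proj T * W w = 0.
Proof. by rewrite -tuple_proj_up -mulrA vv mulr0. Qed.

Let psi_exists : exists psi : leavitt sigma (next G) -> B,
  [/\ star_hom psi,
      forall v, psi (@lvert K sigma (next G) v) = psi_gen (inl v) &
      forall a, psi (@ledge K sigma (next G) a) = psi_gen (inr a)].
Proof.
apply: leavitt_lift => [[w|T] [w'|T']|[w|T]|a|a|[w|T] X a b|[w|T] X] /=;
  rewrite ?inE //.
- exact: vv.
- exact: tuple_proj_mul.
- exact: vs.
- by rewrite mulrA; congr (_ * _); rewrite -{1}[W _]vs -starM EW.
- by rewrite -mulrA TT.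
- case/imsetP => x _ ->; rewrite !inE => /eqP ax /eqP bx.
  rewrite starM starK Ts ax bx mulrA -[_ * E x * _]mulrA -eE -mulrA eT.
    rewrite tuple_proj_mul; case: (eqVneq a b) => [->|n]; first by rewrite eqxx.
    by case: eqP => // hs; case/eqP: n; apply: nedge_inj; rewrite ?hs ?ax.
  by rewrite -bx nbase_in.
- case/imsetP => x; rewrite inE => /eqP <- ->.
  transitivity (\sum_(a | nbase a == x) star (E x) * tuple_proj (nsrc a) * E x).
    rewrite (sum_nbase x (fun T => star (E x) * tuple_proj T * E x)).
    rewrite -mulr_suml -mulr_sumr sum_tuple_proj_edge -mulrA eEx.
    exact/esym/EsE.
  apply: eq_big => [a|a /eqP ->]; first by rewrite inE.
  by rewrite starM starK Ts mulrA -[_ * tuple_proj _ * tuple_proj _]mulrA TT.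
Qed.

(** Every homomorphism that makes the e(x) commute factors through phi, because
    the images P_T of the new vertices and h(x)^* P_T of the new arrows satisfy
    the relations of the next graph.  The formula on arrows is what the induction
    along the canonical sequence consumes. *)
Lemma phi_factorization : exists psi : leavitt sigma (next G) -> B,
  [/\ star_hom psi, forall a, psi (phi a) = h a &
      forall a, psi (nalpha sigma a) =
        star (h (@ledge K sigma G (nbase a))) * tuple_proj (nsrc a)].
Proof.
have [psi [hpsi psiv psie]] := psi_exists.
exists psi; split=> // a.
apply: (@star_hom_ext K sigma G B (fun a => psi (phi a)) h) => {a} //.
- exact: star_hom_comp (phi_hom sigma G) hpsi.
- move=> [u|w]; last by rewrite phi_low psiv.
  rewrite phi_up (hom_sum _ _ _ hpsi) -/(U u) -sum_tuple_proj.
  by apply: eq_bigr => T _; rewrite psiv.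
- move=> x; rewrite phi_edge (hom_sum _ _ _ hpsi) -/(E x).
  transitivity (\sum_(a | nbase a == x) tuple_proj (nsrc a) * E x).
    case: hpsi => _ _ _ hpsiS; apply: eq_bigr => a /eqP ax.
    by rewrite hpsiS psie /= starM starK Ts ax.
  rewrite (sum_nbase x (fun T => tuple_proj T * E x)) -mulr_suml.
  rewrite sum_tuple_proj_edge.
  exact: eEx.
Qed.

End Factorization.

(** * Sums of vertices and surjectivity *)

Section Diagonal.
Variables (K : fieldType) (sigma : involutive_rmorphism K).

(** Sums of vertices with repetition.  Scalars are not included, since only
    stability under addition and commutation matter. *)
Inductive diag (G : bipGraph) : leavitt sigma G -> Prop :=
| diag0 : diag 0
| diag_cons v a : diag a -> diag (@lvert K sigma G v + a).

Section Basics.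
Variable G : bipGraph.
Local Notation A := (leavitt sigma G).

Lemma diagD (a b : A) : diag a -> diag b -> diag (a + b).
Proof.
move=> da db; elim: da => [|v {}a _ IHa]; first by rewrite add0r.
by rewrite -addrA; apply: diag_cons.
Qed.

Lemma diag_vert v : diag (@lvert K sigma G v).
Proof. by rewrite -[lvert _ _]addr0; apply/diag_cons/diag0. Qed.

Lemma diag_sum (I : finType) (P : pred I) (F : I -> A) :
  (forall i, P i -> diag (F i)) -> diag (\sum_(i | P i) F i).
Proof. by move=> h; apply: big_ind => //; [apply: diag0|apply: diagD]. Qed.

Lemma diag1 : diag (1 : A).
Proof. by apply: (@diag_sum _ predT) => v _; apply: diag_vert. Qed.

Lemma diagC (a b : A) : diag a -> diag b -> a * b = b * a.
Proof.
move=> da db; elim: da => [|v {}a _ IHa]; first by rewrite mul0r mulr0.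
rewrite mulrDl mulrDr IHa; congr (_ + _).
elim: db {IHa} => [|w {}b _ IHb]; first by rewrite mul0r mulr0.
rewrite mulrDl mulrDr IHb !leavitt_vert eq_sym.
by case: eqP => [->|].
Qed.

End Basics.

Lemma phi_diag (G : bipGraph) (a : leavitt sigma G) : diag a -> diag (phi a).
Proof.
have [hD _ _ _] := phi_hom sigma G.
elim=> [|v {}a _ IHa]; first by rewrite (hom0 (phi_hom sigma G)); apply: diag0.
rewrite hD; apply: diagD => //; case: v => [u|w].
  by rewrite phi_up; apply: diag_sum => T _; apply: diag_vert.
by rewrite phi_low; apply: diag_vert.
Qed.

Lemma phi_edge_proj (G : bipGraph) (x : bg_edge G) :
  edge_proj (@phi K sigma G) x = \sum_(T | x \in ntuple T) nvert1 sigma T.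
Proof.
have [_ _ hM hS] := phi_hom sigma G.
rewrite /edge_proj hM hS phi_edge star_sum big_distrlr /= -sum_nbase.
have orth (a b : nedge G) : nbase a = x -> nbase b = x ->
    star (nalpha sigma a) * nalpha sigma b =
    if a == b then nvert1 sigma (nsrc a) else 0.
  move=> ax bx; apply: (@leavitt_orth K sigma (next G)
    (inl (bg_src x)) (nblock x)); rewrite ?inE ?ax ?bx //.
  by apply: imset_f; rewrite inE.
apply: eq_bigr => a /eqP ax; rewrite (bigD1 a) ?ax //= starK orth // eqxx.
rewrite big1 ?addr0 // => b /andP [/eqP bx n].
by rewrite starK orth // eq_sym (negbTE n).
Qed.

Lemma phi_edge_proj_diag (G : bipGraph) (x : bg_edge G) :
  diag (edge_proj (@phi K sigma G) x).
Proof. by rewrite phi_edge_proj; apply: diag_sum => T _; apply: diag_vert. Qed.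

(** Both families of projections have the same sum phi(u) over the vertices with
    root u, and P_S v(T) = 0 for S <> T since v(T) = v(T) P_T. *)
Lemma nvert1_tuple_proj (G : bipGraph) (T : nvert G) :
  nvert1 sigma T = tuple_proj (@phi K sigma G) T.
Proof.
have hphi := phi_hom sigma G.
have ec x y : edge_proj (@phi K sigma G) x * edge_proj (@phi K sigma G) y =
    edge_proj (@phi K sigma G) y * edge_proj (@phi K sigma G) x.
  by apply: diagC; apply: phi_edge_proj_diag.
have vT S : nvert1 sigma S * tuple_proj (@phi K sigma G) S = nvert1 sigma S.
  apply: prod_fixr => x xS; rewrite phi_edge_proj mulr_sumr (bigD1 S) //=.
  rewrite /nvert1 leavitt_vert eqxx big1 ?addr0 // => R /andP [_ n].
  rewrite leavitt_vert (_ : (_ == _) = false) //.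
  by apply: contraNF n => /eqP [->].
have cT S R : tuple_proj (@phi K sigma G) S * nvert1 sigma R =
    nvert1 sigma R * tuple_proj (@phi K sigma G) S.
  apply/esym/commr_prod => x _.
  by apply: diagC; [apply: diag_vert|apply: phi_edge_proj_diag].
rewrite -{1}[tuple_proj _ _](tuple_proj_up hphi ec) phi_up mulr_sumr.
rewrite (bigD1 T) //=.
rewrite cT vT big1 ?addr0 // => S /andP [_ n].
rewrite cT -(vT S) -mulrA (tuple_proj_mul hphi ec) (negbTE n); exact: mulr0.
Qed.

Lemma phi1 (G : bipGraph) : phi (1 : leavitt sigma G) = 1.
Proof.
rewrite (hom_sum _ _ _ (phi_hom sigma G) : phi 1 = _).
rewrite [RHS]big_sumType big_sumType /= addrC.
congr (_ + _); first by apply: eq_bigr => w _; apply: phi_low.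
rewrite (partition_big (@nroot G) predT) //=.
by apply: eq_bigr => u _; apply: phi_up.
Qed.

(** The only generators that are not visibly in the image are v(T), a product of
    elements phi(e(x)), and alpha^x(T) = phi(x)^* v(T). *)
Lemma phi_surj (G : bipGraph) (b : leavitt sigma (next G)) :
  exists a, phi a = b.
Proof.
have [hD hZ hM hS] := phi_hom sigma G.
have h1 T : exists a, phi a = nvert1 sigma T :> leavitt sigma (next G).
  rewrite nvert1_tuple_proj; apply: (big_ind (fun b => exists a, phi a = b)).
  - by exists 1; apply: phi1.
  - by move=> _ _ [a <-] [c <-]; exists (a * c).
  - by move=> x _; eexists; apply: erefl.
move: b; apply: leavitt_ind =>
  [|_ _ [a <-] [b <-]|c _ [a <-]|_ _ [a <-] [b <-]|_ [a <-]|[w|T]|a].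
- by exists 0; apply: hom0 (phi_hom sigma G).
- by exists (a + b).
- by exists (sscale c a).
- by exists (a * b).
- by exists (star a).
- by exists (@lvert K sigma G (inr w)); apply: phi_low.
- exact: h1.
- have [b hb] := h1 (nsrc a).
  exists (star (@ledge K sigma G (nbase a)) * b).
  rewrite hM hS hb phi_edge star_sum mulr_suml (bigD1 a) //= starK.
  rewrite (@leavitt_src K sigma (next G) a).
  rewrite big1 ?addr0 // => c /andP [/eqP ca n].
  rewrite starK -[nalpha sigma c](@leavitt_src K sigma (next G) c) -mulrA.
  rewrite leavitt_vert (_ : (_ == _) = false) ?mulr0 //.
  by apply: contraNF n => /eqP [hs]; apply/eqP/nedge_inj.
Qed.

Lemma Phi_hom (G : bipGraph) n : star_hom (@Phi K sigma G n).
Proof. by elim: n => // n IHn; apply: star_hom_comp IHn (phi_hom sigma _). Qed.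

Lemma Phi_surj (G : bipGraph) n (b : leavitt sigma (canon G n)) :
  exists a, Phi n a = b.
Proof.
elim: n b => [b|n IHn b] /=; first by exists b.
by have [c <-] := phi_surj b; have [a <-] := IHn c; exists a.
Qed.

End Diagonal.

(** * Words of length at most n become sums of vertices *)

Section Transverse.
Variables (K : fieldType) (sigma : involutive_rmorphism K).

(** The geometric reason why Phi_n(l) d Phi_n(l)^* has no cross terms: for
    distinct edges x, y of Z, the first condition gives x y^* = 0 and the second
    one gives x^* y = 0. *)
Definition transverse (G : bipGraph) (Z : {set bg_edge G}) : Prop :=
  (forall x y, x \in Z -> y \in Z -> bg_src x = bg_src y -> x = y) /\
  (forall x y (X : {set bg_edge G}), x \in Z -> y \in Z ->
     bg_rng x = bg_rng y -> X \in bg_part (bg_rng x) -> x \in X -> y \in X).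

(** The two conditions exchange their roles.  Arrows of the next graph with the
    same source come from edges of one transversal, which contains at most one
    edge of each block; arrows with the same range come from edges with the same
    source. *)
Lemma transverse_next (G : bipGraph) (Z : {set bg_edge G}) :
  transverse Z -> transverse (G := next G) (@nbase G @^-1: Z).
Proof.
case=> hs hr; split=> [a b|a b X]; rewrite !inE => aZ bZ.
- move=> /= hab; have bb := nbase_in b; rewrite -hab in bb.
  have [X hX aX] := block_of (nbase a).
  have hab' : bg_rng (nbase a) = bg_rng (nbase b).
    by rewrite (ntuple_rng (nbase_in a)) (ntuple_rng bb).
  apply: nedge_inj => //; apply: (@ntuple_inj G (nsrc a) X) => //.
  - by rewrite -(ntuple_rng (nbase_in a)).
  - exact: nbase_in.
  - exact: hr hX aX.
- move=> /= /(hs _ _ aZ bZ) hab /imsetP [x _ ->]; rewrite !inE => /eqP <-.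
  by rewrite hab.
Qed.

Definition edge_sum (G : bipGraph) (Z : {set bg_edge G}) : leavitt sigma G :=
  \sum_(x in Z) @ledge K sigma G x.

Lemma phi_edge_sum (G : bipGraph) (Z : {set bg_edge G}) :
  phi (edge_sum Z) = star (@edge_sum (next G) (@nbase G @^-1: Z)).
Proof.
rewrite /edge_sum (hom_sum _ _ _ (phi_hom sigma G)) star_sum.
rewrite [RHS](partition_big (@nbase G) (mem Z)) /=; last first.
  by move=> a; rewrite inE.
apply: eq_bigr => x xZ; rewrite phi_edge; apply: eq_bigl => a; rewrite inE.
by case: eqP => [->|]; rewrite ?xZ ?andbF.
Qed.

(** The set Z consists of the arrows of E_n lying over the given edge; each step
    of the sequence contributes an involution. *)
Lemma Phi_letter (G : bipGraph) n (l : bg_edge G * bool) :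
  exists (Z : {set bg_edge (canon G n)}) (b : bool), transverse Z /\
    Phi n (@edge_or_star K sigma G l) =
    if b then star (edge_sum Z) else edge_sum Z.
Proof.
elim: n => [|n [Z [b [hZ IHn]]]] /=.
  exists [set l.1], l.2; split; last by rewrite /edge_sum big_set1.
  by split=> [x y|x y X]; rewrite !inE => /eqP -> /eqP ->.
exists (@nbase _ @^-1: Z), (~~ b); split; first exact: transverse_next.
rewrite IHn; case: b {IHn}; last exact: phi_edge_sum.
have [_ _ _ hS] := phi_hom sigma (canon G n).
by rewrite hS phi_edge_sum starK.
Qed.

Lemma edge_vert (G : bipGraph) (x : bg_edge G) v :
  @ledge K sigma G x * @lvert K sigma G v =
  if v == inr (bg_src x) then @ledge K sigma G x else 0.
Proof.
rewrite -[ledge _ _](@leavitt_src K sigma G x) -mulrA leavitt_vert eq_sym.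
case: eqP => // _; exact: mulr0.
Qed.

Lemma star_edge_vert (G : bipGraph) (x : bg_edge G) v :
  star (@ledge K sigma G x) * @lvert K sigma G v =
  if v == inl (bg_rng x) then star (@ledge K sigma G x) else 0.
Proof.
rewrite -[ledge _ _](@leavitt_rng K sigma G x) starM -mulrA leavitt_vstar.
rewrite leavitt_vert eq_sym; case: eqP => // _; exact: mulr0.
Qed.

(** Before phi is applied, z d z^* may contain terms x x^*, which are not sums of
    vertices; this is why each letter of a word costs one step of the
    sequence. *)
Lemma conj_diag (G : bipGraph) (Z : {set bg_edge G}) (b : bool)
    (d : leavitt sigma G) :
  let z := if b then star (edge_sum Z) else edge_sum Z in
  transverse Z -> diag d -> diag (phi (z * d * star z)).
Proof.
move=> z [hs hr]; have hphi := phi_hom sigma G; have [hD _ hM hS] := hphi.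
elim=> [|v {}d _ IHd].
  rewrite mulr0 mul0r (hom0 hphi); exact: diag0.
rewrite mulrDr mulrDl hD; apply: diagD => // {IHd d}.
pose F x := if b then star (@ledge K sigma G x) else @ledge K sigma G x.
have -> : z = \sum_(x in Z) F x
  by rewrite /z /F; clear z F; case: b; rewrite ?star_sum.
rewrite star_sum mulr_suml big_distrlr /= (hom_sum _ _ _ hphi).
apply: diag_sum => x xZ; rewrite (hom_sum _ _ _ hphi); apply: diag_sum => y yZ.
have dx0 : diag (phi (0 : leavitt sigma G)).
  by rewrite (hom0 hphi); apply: diag0.
rewrite /F; clear z F; case: b; rewrite ?starK.
  rewrite star_edge_vert; case: ifP => [_|]; last by rewrite mul0r.
  case: (eqVneq (bg_rng y) (bg_rng x)) => [rxy|n].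
    have [X hX xX] := block_of x.
    rewrite (@leavitt_orth K sigma G (inl (bg_rng x)) X x y hX xX); last first.
      exact: hr hX xX.
    by case: eqP => // _; apply/phi_diag/diag_vert.
  rewrite -[@ledge K sigma G y](@leavitt_rng K sigma G y) mulrA star_edge_vert.
  rewrite (_ : (_ == _) = false) ?mul0r //.
  by apply: contraNF n => /eqP [->].
rewrite edge_vert; case: ifP => [_|]; last by rewrite mul0r.
case: (eqVneq y x) => [->|n]; first exact: phi_edge_proj_diag.
rewrite -[@ledge K sigma G y](@leavitt_src K sigma G y) starM leavitt_vstar.
rewrite mulrA edge_vert.
rewrite (_ : (_ == _) = false) ?mul0r //.
by apply: contraNF n => /eqP [h]; apply/eqP/hs.
Qed.

Lemma Phi_range_proj_diag (G : bipGraph) n (s : seq (bg_edge G * bool)) :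
  (size s <= n)%N ->
  diag (Phi n (range_proj (\prod_(l <- s) @edge_or_star K sigma G l))).
Proof.
elim: n s => [|n IHn] [|l s] //= hs.
- by rewrite big_nil /range_proj mul1r star1; apply: diag1.
- apply: phi_diag; exact: (IHn [::]).
have [Z [b [hZ hl]]] := Phi_letter n l.
have := conj_diag b hZ (IHn s hs); rewrite -hl.
have [_ _ hM hS] := Phi_hom sigma G n.
by rewrite -hS -!hM big_cons /range_proj starM !mulrA.
Qed.

(** Sums of vertices commute, so Phi_n kills the generators of J_n. *)
Lemma J_sub_ker (G : bipGraph) n a : J sigma G n a -> Phi n a = 0.
Proof.
have hPhi := Phi_hom sigma G n; have [hD hZ hM hS] := hPhi.
move/(_ (fun b => Phi n b = 0)); apply=>
  [|b [w [w' [[s hs ->] [s' hs' ->] ->]]]].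
  split=> [|b c hb hc|c b hb|b c hc|b c hb].
  - exact: hom0.
  - by rewrite hD hb hc addr0.
  - by rewrite hZ hb sscaler0.
  - by rewrite hM hc mulr0.
  - by rewrite hM hb mul0r.
rewrite /commutator (homB _ _ hPhi) (hM (range_proj _)) [X in _ - X]hM.
rewrite diagC ?subrr //.
  by apply: (@Phi_range_proj_diag G n s); case/andP: hs.
by apply: (@Phi_range_proj_diag G n s'); case/andP: hs'.
Qed.

End Transverse.

(** * Homomorphisms factoring through the canonical sequence *)

Section Kernel.
Variables (K : fieldType) (sigma : involutive_rmorphism K) (G : bipGraph).
Variables (B : starAlgType sigma) (h : leavitt sigma G -> B) (n : nat).
Hypothesis hh : star_hom h.
Local Notation letter := (bg_edge G * bool)%type.
Local Notation word s := (\prod_(l <- s) @edge_or_star K sigma G l).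

Let rproj (s : seq letter) : B := h (range_proj (word s)).
Hypothesis rproj_comm : forall s t,
  (0 < size s <= n)%N -> (0 < size t <= n)%N ->
  rproj s * rproj t = rproj t * rproj s.

Let hM a b : h (a * b) = h a * h b. Proof. by case: hh. Qed.
Let hS a : h (star a) = star (h a). Proof. by case: hh. Qed.
Let gimg (l : letter) : B := h (@edge_or_star K sigma G l).

(** Products of elements h(e(w)), w a nonempty word of length at most m. *)
Inductive range_prod (m : nat) : B -> Prop :=
| range_prod1 : range_prod m 1
| range_prod_cons s p :
    (0 < size s <= m)%N -> range_prod m p -> range_prod m (rproj s * p).

Lemma range_prodM m p p' :
  range_prod m p -> range_prod m p' -> range_prod m (p * p').
Proof.
move=> dp dp'; elim: dp => [|s {}p hs _ IHp]; first by rewrite mul1r.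
by rewrite -mulrA; apply: range_prod_cons.
Qed.

Lemma range_prod_word m s : (0 < size s <= m)%N -> range_prod m (rproj s).
Proof.
move=> hs; rewrite -[rproj s]mulr1.
exact: range_prod_cons hs (range_prod1 _).
Qed.

Lemma range_prodW m m' p : (m <= m')%N -> range_prod m p -> range_prod m' p.
Proof.
move=> hm; elim=> [|s {}p /andP [hs hs'] _ IHp]; first exact: range_prod1.
by apply: range_prod_cons IHp; rewrite hs (leq_trans hs').
Qed.

Lemma range_prodC p p' : range_prod n p -> range_prod n p' -> p * p' = p' * p.
Proof.
move=> dp dp'; elim: dp => [|s {}p hs _ IHp]; first by rewrite mul1r mulr1.
rewrite -mulrA IHp !mulrA; congr (_ * _).
elim: dp' {IHp} => [|t {}p' ht _ IHp]; first by rewrite mul1r mulr1.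
by rewrite mulrA rproj_comm // -!mulrA IHp.
Qed.

Let rproj_star s : star (rproj s) = rproj s.
Proof. by rewrite -hS /range_proj starM starK. Qed.

Lemma range_prod_star p : range_prod n p -> star p = p.
Proof.
elim=> [|s {}p hs dp IHp]; first exact: star1.
rewrite starM IHp rproj_star; apply: range_prodC => //; exact: range_prod_word.
Qed.

Let rproj1 l : rproj [:: l] = gimg l * star (gimg l).
Proof. by rewrite /rproj /range_proj big_seq1 hM hS. Qed.

Let rproj_cons l s : rproj (l :: s) = gimg l * rproj s * star (gimg l).
Proof. by rewrite /rproj /range_proj big_cons starM !(hM, hS) !mulrA. Qed.

Let flip (l : letter) : letter := (l.1, ~~ l.2).

Let gimg_flip l : gimg (flip l) = star (gimg l).
Proof.
by case: l => x [] /=; rewrite /gimg /edge_or_star /= -hS ?starK.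
Qed.

Let gimg_partial l : gimg l * star (gimg l) * gimg l = gimg l.
Proof.
have hx x : let e := @ledge K sigma G x in e * star e * e = e.
  have [X hX xX] := block_of x; rewrite /= -mulrA.
  rewrite (@leavitt_orth K sigma G (inl (bg_rng x)) X x x hX xX xX) eqxx.
  exact: leavitt_src.
rewrite /gimg -hS -!hM; congr h; case: l => x [] /=; last exact: hx.
by have := congr1 star (hx x); rewrite /edge_or_star /= !starM !starK mulrA.
Qed.

(** Conjugation by a letter l is multiplicative on these products: the projection
    h(l)^* h(l) = h(e(l^* )) commutes with the factors, hence can be inserted
    between them. *)
Lemma range_prod_conj m l p : (m < n)%N -> range_prod m p ->
  range_prod m.+1 (gimg l * p * star (gimg l)).
Proof.
move=> hm; elim=> [|s {}p hs dp IHp].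
  by rewrite mulr1 -rproj1; apply: range_prod_word.
have -> : gimg l * (rproj s * p) * star (gimg l) =
    rproj (l :: s) * (gimg l * p * star (gimg l)); last first.
  by apply: range_prod_cons IHp; case/andP: hs.
have hs' : (0 < size s <= n)%N.
  by case/andP: hs => -> hs; apply: leq_trans hs (ltnW hm).
have hc : rproj s * (star (gimg l) * gimg l) =
    star (gimg l) * gimg l * rproj s.
  have -> : star (gimg l) * gimg l = rproj [:: flip l].
    by rewrite rproj1 gimg_flip starK.
  by apply: rproj_comm => //=; rewrite (leq_ltn_trans (leq0n m)).
transitivity
  (gimg l * (star (gimg l) * gimg l * rproj s) * p * star (gimg l)).
  by rewrite !mulrA gimg_partial.
by rewrite -hc rproj_cons !mulrA.
Qed.

(** The last clause is the inductive invariant; it makes the k(e(f)) products of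
    elements h(e(w)) with w of length at most m + 1, hence commuting as long as
    m < n. *)
Lemma Phi_factorization m : (m <= n)%N ->
  exists k : leavitt sigma (canon G m) -> B,
  [/\ star_hom k, forall a, k (Phi m a) = h a &
      forall f : bg_edge (canon G m), exists l p,
        range_prod m p /\ k (@ledge K sigma (canon G m) f) = gimg l * p].
Proof.
elim: m => [|m IHm] hm.
  exists h; split=> // f; exists (f, false), 1; split; first exact: range_prod1.
  by rewrite mulr1.
have [k [hk kPhi kedge]] := IHm (ltnW hm).
have ke f : range_prod m.+1 (edge_proj k f).
  have [l [p [dp hf]]] := kedge f.
  have [_ _ kM kS] := hk.
  rewrite /edge_proj kM kS hf starM.
  rewrite (range_prod_star (range_prodW (ltnW hm) dp)).
  rewrite mulrA -[gimg l * p * p]mulrA; apply: range_prod_conj => //.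
  exact: range_prodM.
have kc f f' : edge_proj k f * edge_proj k f' = edge_proj k f' * edge_proj k f.
  by apply: range_prodC; apply: range_prodW hm _; apply: ke.
have [psi [hpsi psiphi psie]] := phi_factorization hk kc.
exists psi; split=> // [a|a]; first by rewrite psiphi.
have [l [p [dp hf]]] := kedge (nbase a).
(* psi maps the arrow a to (h(l) p)^* P_T = p h(l)^* P_T; moving the letter to
   the left turns p into its conjugate by l, of length at most m + 1. *)
have pl : p * star (gimg l) = star (gimg l) * (gimg l * p * star (gimg l)).
  have hc : star (gimg l) * gimg l * p = p * (star (gimg l) * gimg l).
    have -> : star (gimg l) * gimg l = rproj [:: flip l].
      by rewrite rproj1 gimg_flip starK.
    apply: range_prodC; last exact: range_prodW (ltnW hm) dp.
    by apply: range_prod_word => /=; rewrite (leq_ltn_trans (leq0n m)).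
  have := gimg_partial (flip l); rewrite gimg_flip starK => gl.
  by rewrite !mulrA hc -!mulrA; congr (_ * _); rewrite mulrA.
exists (flip l), (gimg l * p * star (gimg l) * tuple_proj k (nsrc a)); split.
  apply: range_prodM; first exact: range_prod_conj.
  apply: (big_ind (range_prod m.+1)); first exact: range_prod1.
    exact: range_prodM.
  by move=> x _; apply: ke.
rewrite psie hf gimg_flip starM.
rewrite (range_prod_star (range_prodW (ltnW hm) dp)) pl.
by rewrite !mulrA.
Qed.

End Kernel.

(** * The kernel of Phi_n *)

Lemma ker_Phi (K : fieldType) (sigma : involutive_rmorphism K) (G : bipGraph)
    (n : nat) (a : leavitt sigma G) : Phi n a = 0 <-> J sigma G n a.
Proof.
split=> [Pa|]; last exact: J_sub_ker.
have hq := qproj_hom (J sigma G n); have [_ _ qM _] := hq.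
have [|k [hk kPhi _]] := @Phi_factorization K sigma G _ _ n hq _ n (leqnn n).
  move=> s t hs ht; rewrite -!qM; apply: qprojE => I _; apply.
  by do 2 eexists; split; [exists s|exists t|].
have : qproj (J sigma G n) a = qproj (J sigma G n) 0.
  by rewrite -kPhi Pa (hom0 hk) (hom0 hq).
by move/eqP/qprojP; rewrite subr0.
Qed.

Theorem theorem5p7 (K : fieldType) (sigma : involutive_rmorphism K)
    (G : bipGraph) (n : nat) (n_ge1 : (1 <= n)%N) :
  (forall a : leavitt sigma G, Phi n a = 0 <-> J sigma G n a) /\
  (exists f : qalg (J sigma G n) -> leavitt sigma (canon G n),
     [/\ bijective f, star_hom f &
         forall a : leavitt sigma G, f (qproj (J sigma G n) a) = Phi n a]).
Proof.
split; first exact: ker_Phi.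
have hPhi := @Phi_hom K sigma G n; have [PD PZ PM PS] := hPhi.
have [qD qZ qM qS] := qproj_hom (J sigma G n).
pose f (x : qalg (J sigma G n)) := Phi n (repr x).
have fE a : f (qproj (J sigma G n) a) = Phi n a.
  apply/eqP; rewrite -subr_eq0 -(homB _ _ hPhi); apply/eqP/ker_Phi.
  by apply/qprojP; rewrite /qproj reprK.
have ex x : exists a, qproj (J sigma G n) a = x := qproj_surj x.
exists f; split=> //.
  have finj x y : f x = f y -> x = y.
    have [a <-] := ex x; have [b <-] := ex y; rewrite !fE => ab.
    by apply/qprojE/ker_Phi; rewrite (homB _ _ hPhi) ab subrr.
  have inv b := cid (@Phi_surj K sigma G n b).
  exists (fun b => qproj (J sigma G n) (sval (inv b))) => [x|b].
    by apply: finj; rewrite fE; apply: (svalP (inv _)).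
  by rewrite fE; apply: (svalP (inv _)).
split=> [x y|c x|x y|x].
- by have [a <-] := ex x; have [b <-] := ex y; rewrite -qD !fE.
- by have [a <-] := ex x; rewrite -qZ !fE.
- by have [a <-] := ex x; have [b <-] := ex y; rewrite -qM !fE.
- by have [a <-] := ex x; rewrite -qS !fE.
Qed.
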